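(* Consider the invariant line $[G,D]$ with viscosity ratio satisfying $1<\nu_G\le 8$. The surface of undercompressive shocks $\mathcal{T}$ associated with the invariant plane $[G,D]\times\mathbb{R}^+$ (represented by $\mathcal{T}^-$ and $\mathcal{T}^+$, for the identity viscosity matrix) is bounded by the following curves: (1) the curves $SCB^-\subset\mathcal{T}^-$ and $SCB^+\subset\mathcal{T}^+$, connecting the points $\widehat{D}_1$ and $\widehat{\mathcal{U}}$, and $\widehat{\mathcal{U}}$ and $\widehat{D}$, respectively; (2) the curves $FCB^-\subset\mathcal{T}^-$ and $FCB^+\subset\mathcal{T}^+$, connecting the points $\widehat{\mathcal{Y}}^G$ and $\widehat{\mathcal{U}}$, and $\widehat{\mathcal{U}}$ and $\widehat{\mathrm{Y}}^G$, respectively; (3) the curves $UCB^-\subset\mathcal{T}^-$ and $UCB^+\subset\mathcal{T}^+$, connecting the points $\widehat{D}_2$ and $\widehat{\mathcal{Y}}^G$, and $\check{D}$ and $\widehat{\mathrm{Y}}^G$, respectively; (4) the curves $GUB^-\subset\mathcal{T}^-$ and $GUB^+\subset\mathcal{T}^+$, connecting the points $\widehat{D}_2$ and $\widehat{D}_1$, and $\check{D}$ and $\widehat{D}$, respectively.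
   Context: Model. Let $\mu_w,\mu_o,\mu_g>0$. States are $U=(s_w,s_o)\in\Omega=\{s_w,s_o\ge0,\ s_w+s_o\le1\}$, $s_g=1-s_w-s_o$. The flux is $F=(f_w,f_o)$, $f_i=(s_i^2/\mu_i)/(\sum_{j\in\{w,o,g\}}s_j^2/\mu_j)$; $\lambda_s\le\lambda_f$ are the eigenvalues of $DF$. The umbilic point is $\mathcal{U}$ with $(s_w,s_o,s_g)=(\mu_w,\mu_o,\mu_g)/(\mu_w+\mu_o+\mu_g)$. Invariant line. $G$ is the vertex $s_g=1$; $\nu_G=(\mu_w+\mu_o)/\mu_g$; $[G,D]$ is the set of states with $s_w/\mu_w=s_o/\mu_o$, parametrized by $s=s_w+s_o\in[0,1]$ ($s=0$ at $G$, $s=1$ at $D$, on the edge $s_g=0$); $s_M$ is the parameter of a state $M$. One has $s_{\mathcal{U}}=\nu_G/(1+\nu_G)$. With $E(s)=s^2+\nu_G(1-s)^2$, the eigenvalues along the line are $\lambda_a=2s/E$ and $\lambda_b=2\nu_Gs(1-s)/E^2$, $\lambda_s=\min$, $\lambda_f=\max$; the Rankine-Hugoniot speed between states of the line is $\sigma(M;N)=\nu_G(s_M+s_N-2s_Ms_N)/(E(s_M)E(s_N))$. Shocks (viscosity matrix equal to identity). A shock from $U^-$ (left) to $U^+$ (right) with speed $\sigma$ satisfies $F(U^+)-F(U^-)=\sigma(U^+-U^-)$ and has an orbit of $\dot U=F(U)-F(U^-)-\sigma(U-U^-)$ from $U^-$ to $U^+$. It is: undercompressive (a $u$-shock) if $\lambda_s(U^\pm)<\sigma<\lambda_f(U^\pm)$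 (saddle to saddle); a left-characteristic $s$-shock if $\lambda_s(U^+)<\sigma=\lambda_s(U^-)$ and $\sigma<\lambda_f(U^+)$; a right-characteristic $f$-shock if $\lambda_f(U^+)=\sigma<\lambda_f(U^-)$ and $\lambda_s(U^-)<\sigma$; a left-characteristic $u$-shock if $\lambda_s(U^-)<\sigma=\lambda_f(U^-)$ and $\lambda_s(U^+)<\sigma<\lambda_f(U^+)$. Special states on $[G,D]$. $D_1,D_2$: $\lambda_s(D_1)=\sigma(D_1;D)$ with $s_{D_1}=\nu_G/(2+\nu_G)$, and $\lambda_f(D_2)=\sigma(D_2;D)$ with $s_{D_2}=(\sqrt{\nu_G+1}-1)/\sqrt{\nu_G+1}$. Fast double contact states $\mathcal{Y}^G,\mathrm{Y}^G$: $\sigma(\mathcal{Y}^G;\mathrm{Y}^G)=\lambda_f(\mathcal{Y}^G)=\lambda_f(\mathrm{Y}^G)$, $s_{\mathcal{Y}^G}=\frac12\sqrt{2\nu_G/(\nu_G+1)}$, $s_{\mathrm{Y}^G}=\frac{\nu_G+\sqrt{2\nu_G(\nu_G+1)}}{2(\nu_G+2)}$. Undercompressive interval. For $M\in(\mathcal{U},D]$, $\mathfrak{S}(M)\in[G,\mathcal{U})$ is the state with $\sigma(\mathfrak{S};M)=\lambda_s(\mathfrak{S})$; $\mathcal{F}(M)\in[G,\mathcal{U})$ is the state with $\sigma(\mathcal{F};M)=\lambda_f(M)$ if $s_M\in(s_{\mathcal{U}},s_{\mathrm{Y}^G}]$ (the one with largest $s_{\mathcal{F}}$), and with $\sigma(\mathcal{F};M)=\lambda_f(\mathcal{F})$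 if $s_M\in(s_{\mathrm{Y}^G},1]$. States $U$ strictly between $\mathcal{F}(M)$ and $\mathfrak{S}(M)$ are joined to $M$ by an undercompressive shock. Write $\sigma_{\mathfrak{S}}=\sigma(\mathfrak{S}(M);M)$, $\sigma_{\mathcal{F}}=\sigma(\mathcal{F}(M);M)$. Surface. In $\Omega\times\mathbb{R}^+$ (state, speed) put $\mathcal{C}_M^-=\{(U,\sigma(U;M)):U\in[\mathcal{F}(M),\mathfrak{S}(M)]\}$ and $\mathcal{C}_M^+=\{(M,v):\sigma_{\mathfrak{S}}\le v\le\sigma_{\mathcal{F}}\}$. The undercompressive surface $\mathcal{T}$ is represented in $(U^-,\sigma)$-coordinates by $\mathcal{T}^-=\bigcup_{M\in(\mathcal{U},D]}\mathcal{C}_M^-$ and in $(U^+,\sigma)$-coordinates by $\mathcal{T}^+=\bigcup_{M\in(\mathcal{U},D]}\mathcal{C}_M^+$; both lie in the plane $[G,D]\times\mathbb{R}^+$. Boundary curves (with $M\in(\mathcal{U},D]$; the superscript $-$ collects the left-state points, $+$ the right-state points; end points are included as limits). $SCB$ (slow characteristic boundary): $SCB^-=\{(\mathfrak{S},\sigma(\mathfrak{S};M))\}$, $SCB^+=\{(M,\sigma(\mathfrak{S};M))\}$ over pairs $\mathfrak{S}\in[G,\mathcal{U})$, $M$ joined by a left-characteristic $s$-shock. $FCB$ (fast characteristic boundary): $FCB^-=\{(\mathcal{F},\sigma(\mathcal{F};M))\}$, $FCB^+=\{(M,\sigma(\mathcal{F};M))\}$ over pairs $\mathcal{F}=\mathcal{F}(M)\in[G,\mathcal{U})$,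 $M$ joined by a right-characteristic $f$-shock ($\sigma=\lambda_f(M)$). $UCB$ (undercompressive characteristic boundary): $UCB^-=\{(\mathcal{F},\sigma(\mathcal{F};M))\}$, $UCB^+=\{(M,\sigma(\mathcal{F};M))\}$ over pairs $\mathcal{F}=\mathcal{F}(M)\in[G,\mathcal{U})$, $M$ joined by a left-characteristic $u$-shock ($\sigma=\lambda_f(\mathcal{F})$). $GUB$ (genuine undercompressive boundary): $GUB^-=\{(U,\sigma(U;D))\}$, $GUB^+=\{(D,\sigma(U;D))\}$ over $U\in(\mathcal{F}(D),\mathfrak{S}(D))$. Lifted points. $\widehat{\mathcal{U}}=(\mathcal{U},2)$ where $2=\lambda_s(\mathcal{U})=\lambda_f(\mathcal{U})$; $\widehat{D}_1=(D_1,\sigma(D_1;D))$; $\widehat{D}=(D,\sigma(D_1;D))$; $\widehat{D}_2=(D_2,\sigma(D_2;D))$; $\check{D}=(D,\sigma(D_2;D))$; $\widehat{\mathcal{Y}}^G=(\mathcal{Y}^G,\sigma(\mathcal{Y}^G;\mathrm{Y}^G))$; $\widehat{\mathrm{Y}}^G=(\mathrm{Y}^G,\sigma(\mathcal{Y}^G;\mathrm{Y}^G))$. *)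

(* Defs.v *)
From HB Require Import structures.
From mathcomp Require Import all_boot all_order all_algebra.
From mathcomp Require Import all_classical all_reals all_analysis.

Set Implicit Arguments.
Unset Strict Implicit.
Unset Printing Implicit Defensive.

Import Order.TTheory GRing.Theory Num.Theory.
Import numFieldNormedType.Exports.

Local Open Scope classical_set_scope.
Local Open Scope ring_scope.

                                                                         
                        

Record viscosity (R : realType) := Viscosity {
  mu_w : R;
  mu_o : R;
  mu_g : R }.

Definition state (R : realType) := 'rV[R]_2.

Section Model.
Context {R : realType}.
Implicit Types U V M X Um Up : state R.

Definition mk_state (a b : R) : state R :=
  \row_(i < 2) (if i == 0 then a else b).

Definition sw U : R := U 0 0.
Definition so U : R := U 0 1.
Definition sg U : R := 1 - sw U - so U.

Definition Omega : set (state R) :=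
  [set U | [/\ 0 <= sw U, 0 <= so U & sw U + so U <= 1]].

Definition mobility (mu : viscosity R) U : R :=
  sw U ^+ 2 / mu_w mu + so U ^+ 2 / mu_o mu + sg U ^+ 2 / mu_g mu.

                                                                            
                                                                  
Definition flux (mu : viscosity R) U : state R :=
  mk_state (sw U ^+ 2 / mu_w mu / mobility mu U)
           (so U ^+ 2 / mu_o mu / mobility mu U).

                                                                           
                                                    
Definition eigenvalues (mu : viscosity R) U : set R :=
  [set a | eigenvalue ('J (flux mu) U) a].

                                                                          
Definition lambda_s (mu : viscosity R) U : R := inf (eigenvalues mu U).
Definition lambda_f (mu : viscosity R) U : R := sup (eigenvalues mu U).

                                                             
Definition rh_speed (mu : viscosity R) M X : R :=
  get [set v : R | flux mu X - flux mu M = v *: (X - M)].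

Definition orbit_of (mu : viscosity R) Um Up (v : R) (phi : R -> state R) :=
  [/\ forall t, Omega (phi t),
      forall t : R, is_derive t 1 phi
        (flux mu (phi t) - flux mu Um - v *: (phi t - Um)),
      phi t @[t --> -oo] --> Um &
      phi t @[t --> +oo] --> Up].

Definition shock (mu : viscosity R) Um Up (v : R) : Prop :=
  flux mu Up - flux mu Um = v *: (Up - Um) /\
  exists phi : R -> state R, orbit_of mu Um Up v phi.

Definition left_char_s_shock (mu : viscosity R) Um Up (v : R) : Prop :=
  [/\ shock mu Um Up v, lambda_s mu Up < v, v = lambda_s mu Um
    & v < lambda_f mu Up].

Definition right_char_f_shock (mu : viscosity R) Um Up (v : R) : Prop :=
  [/\ shock mu Um Up v, lambda_f mu Up = v, v < lambda_f mu Um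
    & lambda_s mu Um < v].

Definition left_char_u_shock (mu : viscosity R) Um Up (v : R) : Prop :=
  [/\ shock mu Um Up v, lambda_s mu Um < v /\ v = lambda_f mu Um
    & lambda_s mu Up < v < lambda_f mu Up].

Definition nuG (mu : viscosity R) : R := (mu_w mu + mu_o mu) / mu_g mu.

Definition segment_GD (mu : viscosity R) : set (state R) :=
  [set U | Omega U /\ sw U / mu_w mu = so U / mu_o mu].

Definition param U : R := sw U + so U.

                                                                           
                                               
Definition line_state (mu : viscosity R) (s : R) : state R :=
  mk_state (s * mu_w mu / (mu_w mu + mu_o mu))
           (s * mu_o mu / (mu_w mu + mu_o mu)).

Definition umbilic (mu : viscosity R) : state R :=
  mk_state (mu_w mu / (mu_w mu + mu_o mu + mu_g mu))
           (mu_o mu / (mu_w mu + mu_o mu + mu_g mu)).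

Definition pt_D (mu : viscosity R) : state R := line_state mu 1.

Definition pt_D1 (mu : viscosity R) : state R :=
  line_state mu (nuG mu / (2 + nuG mu)).

Definition pt_D2 (mu : viscosity R) : state R :=
  line_state mu ((Num.sqrt (nuG mu + 1) - 1) / Num.sqrt (nuG mu + 1)).

                                                                             
               
Definition calY (mu : viscosity R) : state R :=
  line_state mu (2^-1 * Num.sqrt (2 * nuG mu / (nuG mu + 1))).

Definition pt_Y (mu : viscosity R) : state R :=
  line_state mu ((nuG mu + Num.sqrt (2 * nuG mu * (nuG mu + 1)))
                 / (2 * (nuG mu + 2))).

                                                                        
Definition seg_GU (mu : viscosity R) : set (state R) :=
  [set X | segment_GD mu X /\ param X < param (umbilic mu)].

Definition seg_UD (mu : viscosity R) : set (state R) :=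
  [set M | segment_GD mu M /\ param (umbilic mu) < param M].

Definition frakS (mu : viscosity R) M : state R :=
  get [set X | seg_GU mu X /\ rh_speed mu X M = lambda_s mu X].

Definition calF_low (mu : viscosity R) M : set (state R) :=
  [set X | seg_GU mu X /\ rh_speed mu X M = lambda_f mu M].

Definition calF_high (mu : viscosity R) M : set (state R) :=
  [set X | seg_GU mu X /\ rh_speed mu X M = lambda_f mu X].

Definition calF (mu : viscosity R) M : state R :=
  if param M <= param (pt_Y mu) then
    get [set X | calF_low mu M X /\
                 forall X', calF_low mu M X' -> param X' <= param X]
  else get (calF_high mu M).

Definition sigma_S (mu : viscosity R) M : R := rh_speed mu (frakS mu M) M.
Definition sigma_F (mu : viscosity R) M : R := rh_speed mu (calF mu M) M.

Definition C_minus (mu : viscosity R) M : set (state R * R) :=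
  [set p | exists2 U, segment_GD mu U &
     param (calF mu M) <= param U <= param (frakS mu M) /\
     p = (U, rh_speed mu U M)].

Definition C_plus (mu : viscosity R) M : set (state R * R) :=
  [set p | exists2 v : R, sigma_S mu M <= v <= sigma_F mu M & p = (M, v)].

Definition T_minus (mu : viscosity R) : set (state R * R) :=
  \bigcup_(M in seg_UD mu) C_minus mu M.

Definition T_plus (mu : viscosity R) : set (state R * R) :=
  \bigcup_(M in seg_UD mu) C_plus mu M.

Definition SCB_pairs (mu : viscosity R) : set (state R * state R) :=
  [set p | [/\ seg_GU mu p.1, seg_UD mu p.2 &
    left_char_s_shock mu p.1 p.2 (rh_speed mu p.1 p.2)]].

Definition FCB_pairs (mu : viscosity R) : set (state R * state R) :=
  [set p | [/\ seg_GU mu p.1, seg_UD mu p.2, p.1 = calF mu p.2 &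
    right_char_f_shock mu p.1 p.2 (rh_speed mu p.1 p.2)]].

Definition UCB_pairs (mu : viscosity R) : set (state R * state R) :=
  [set p | [/\ seg_GU mu p.1, seg_UD mu p.2, p.1 = calF mu p.2 &
    left_char_u_shock mu p.1 p.2 (rh_speed mu p.1 p.2)]].

Definition GUB_pairs (mu : viscosity R) : set (state R * state R) :=
  [set p | [/\ segment_GD mu p.1, p.2 = pt_D mu &
    param (calF mu (pt_D mu)) < param p.1 < param (frakS mu (pt_D mu))]].

                                                    
Definition left_curve (mu : viscosity R) (P : set (state R * state R)) :
    set (state R * R) :=
  [set (p.1, rh_speed mu p.1 p.2) | p in P].

Definition right_curve (mu : viscosity R) (P : set (state R * state R)) :
    set (state R * R) :=
  [set (p.2, rh_speed mu p.1 p.2) | p in P].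

Definition U_hat (mu : viscosity R) : state R * R := (umbilic mu, 2).
Definition D1_hat (mu : viscosity R) : state R * R :=
  (pt_D1 mu, rh_speed mu (pt_D1 mu) (pt_D mu)).
Definition D_hat (mu : viscosity R) : state R * R :=
  (pt_D mu, rh_speed mu (pt_D1 mu) (pt_D mu)).
Definition D2_hat (mu : viscosity R) : state R * R :=
  (pt_D2 mu, rh_speed mu (pt_D2 mu) (pt_D mu)).
Definition D_check (mu : viscosity R) : state R * R :=
  (pt_D mu, rh_speed mu (pt_D2 mu) (pt_D mu)).
Definition calY_hat (mu : viscosity R) : state R * R :=
  (calY mu, rh_speed mu (calY mu) (pt_Y mu)).
Definition Y_hat (mu : viscosity R) : state R * R :=
  (pt_Y mu, rh_speed mu (calY mu) (pt_Y mu)).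

                                                                           
                                                                              
                                                                            
                                                                
Definition plane_chart (mu : viscosity R) (p : R * R) : state R * R :=
  (line_state mu p.1, p.2).

Definition plane_boundary (mu : viscosity R) (A : set (state R * R)) :
    set (state R * R) :=
  let B := plane_chart mu @^-1` A in
  plane_chart mu @` (closure B `\` interior B).

End Model.

Section Curves.
Context {R : realType}.
Implicit Types (A : set (state R * R)) (p q : state R * R).

Definition with_ends A p q : set (state R * R) := A `|` [set p; q].

                                                                          
                                     
Definition arc_from_to A p q : Prop :=
  (exists gamma : R -> state R * R,
    [/\ {within `[0, 1], continuous gamma}, set_inj `[0, 1] gamma,
        gamma 0 = p, gamma 1 = q & gamma @` `[0, 1] = A]) \/
  (p = q /\ A = [set p]).

                                                                            
                                                                            
                                                        
Definition connects_in (mu : viscosity R) (T A : set (state R * R)) p q :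
    Prop :=
  with_ends A p q `\ U_hat mu `<=` T /\ arc_from_to (with_ends A p q) p q.

End Curves.

(* Main.v *)
Require Import Defs.
From mathcomp Require Import all_boot all_order all_algebra.
From mathcomp Require Import ring lra.
From mathcomp Require Import all_classical all_reals all_analysis.
Import Order.TTheory GRing.Theory Num.Theory.
Import numFieldNormedType.Exports.
Local Open Scope classical_set_scope.
Local Open Scope ring_scope.

(** On the line from G to D the flux points along the line and reduces to the
    S-shaped scalar flux [s ^+ 2 / mobl s], so shocks between two states of the
    line are chords of one graph.  The Jacobian there has two fixed
    eigenvectors, the direction of the line and [dirT]; the eigenvalue
    [lam_along] of the former is the slope of the graph, the eigenvalue
    [lam_cross] of the latter is [2 * s / mobl s], and their order changes at the
    umbilic point only.  Hence every condition in the statement compares the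
    slope of a chord with a tangent slope or with [lam_cross].

    Two elementary objects decide all these comparisons.  Three abscissae lie on
    one chord exactly when the symmetric polynomial [collin] vanishes, and
    [collin] increases in each argument on the unit interval; its sign compares
    two chords, or a chord and a tangent.  A chord from x to m has speed at
    least [lam_cross x] exactly when [x <= contact m], because that comparison is
    linear in x.  The map [contact] therefore gives the slow end state [contact m]
    of M and, read backwards, the right state [contact x] of a
    right-characteristic f-shock from x.  It increases up to [sCY], where it takes
    the value [sY], and decreases afterwards.  The hypothesis [1 < nu] puts the
    umbilic point on the decreasing branch, and [nu <= 8] says [sY <= 1], that is,
    the fast double contact lies on the segment.  For M beyond [sY] the fast end
    state is the point of tangency [tangent m] instead.

    With this, u lies between the fast and slow end states of m exactly when
    [joinable u m] ([fast_end_joinable]).  In the plane (parameter, speed), the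
    surface seen from the left states is the band between [lower_minus] and
    [upper_minus] over [[sD2, sU)] ([speed_range_minus]), and seen from the right
    states the band between [lower_plus] and [upper_plus] over [(sU, 1]].  The
    frontier of such a band consists of the two graphs and the vertical sides
    ([band_boundary]).  Apart from [lower_plus] the bounding functions are maxima or
    minima of two explicit functions, which cross at [sD1], [sCY] and [sY]: the
    pieces are SCB, FCB, UCB and GUB, and the lifted points are where consecutive
    pieces meet.

    The curves are defined through shocks with a viscous profile, so each chord
    used needs an orbit.  The line is invariant, and on it the profile equation is
    scalar with a right-hand side that is positive between x and m as soon as
    [0 <= collin x x m].  A logistic change of the unknown turns the search for
    an orbit into the inversion of an explicit increasing function of time
    ([heteroclinic]). *)

Set Implicit Arguments.
Unset Strict Implicit.
Unset Printing Implicit Defensive.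

(** * Chords and characteristic speeds of the reduced flux *)

Section ScalarModel.
Context {R : realType} (nu : R).
Implicit Types (s t u v x m : R).

(** Along the line the total mobility is [mobl s / (mu_w mu + mu_o mu)]. *)
Definition mobl s : R := s ^+ 2 + nu * (1 - s) ^+ 2.

(** Eigenvalue of the direction transversal to the line. *)
Definition lam_cross s : R := 2 * s / mobl s.

(** Derivative of the reduced flux [s ^+ 2 / mobl s], the eigenvalue of the
    direction of the line. *)
Definition lam_along s : R := 2 * nu * s * (1 - s) / mobl s ^+ 2.

(** Slope of the chord of the graph of [s ^+ 2 / mobl s] between x and m; this
    closed form also makes sense for [x = m]. *)
Definition chord x m : R := nu * (x + m - 2 * x * m) / (mobl x * mobl m).

(** Numerator of a difference of chord slopes after division by its obvious
    root; for distinct abscissae it vanishes exactly when the three points of the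
    graph are collinear. *)
Definition collin x s m : R :=
  (1 + nu) * (x * s + s * m + m * x - 2 * x * s * m) - nu.
Definition contact_den t : R := 2 * (1 + nu) * t ^+ 2 - 2 * nu * t + nu.

(** Solution x of [chord x t = lam_cross x]. *)
Definition contact t : R := nu * t / contact_den t.

(** For m right of the umbilic point, the root in the unit interval of the
    quadratic equation [collin x x m = 0], rationalized so that the zero of the
    leading coefficient at [m = 1 / 2] does no harm: the chord from this abscissa
    to m is tangent to the graph at its left end. *)
Definition tangent m : R :=
  nu / ((1 + nu) * m + Num.sqrt ((1 + nu) * mobl m)).

Definition sU : R := nu / (1 + nu).
Definition sD1 : R := nu / (2 + nu).
Definition sD2 : R := (Num.sqrt (nu + 1) - 1) / Num.sqrt (nu + 1).

(** Left state of the fast double contact; its right state is [sY]. *)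
Definition sCY : R := 2^-1 * Num.sqrt (2 * nu / (nu + 1)).
Definition sY : R :=
  (nu + Num.sqrt (2 * nu * (nu + 1))) / (2 * (nu + 2)).

Hypothesis nu1 : 1 < nu.

Lemma nu_gt0 : 0 < nu. Proof. by move: nu1; lra. Qed.
Hint Resolve nu_gt0 : core.
Lemma nup1_gt0 : 0 < 1 + nu. Proof. by move: nu1; lra. Qed.
Hint Resolve nup1_gt0 : core.

Lemma mobl_gt0 s : 0 < mobl s.
Proof.
rewrite -(pmulr_rgt0 _ nup1_gt0).
have -> : (1 + nu) * mobl s = ((1 + nu) * s - nu) ^+ 2 + nu by rewrite /mobl; ring.
by rewrite ltr_wpDl ?sqr_ge0.
Qed.
Hint Resolve mobl_gt0 : core.

Lemma contact_den_gt0 s : 0 < contact_den s.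
Proof.
have k2 : 0 < 2 * (1 + nu) by rewrite mulr_gt0.
rewrite -(pmulr_rgt0 _ k2).
have -> : 2 * (1 + nu) * contact_den s
    = (2 * (1 + nu) * s - nu) ^+ 2 + nu * (nu + 2) by rewrite /contact_den; ring.
by rewrite ltr_wpDl ?sqr_ge0// mulr_gt0//; move: nu1; lra.
Qed.
Hint Resolve contact_den_gt0 : core.

Lemma mobl_neq0 s : mobl s != 0. Proof. by rewrite gt_eqF. Qed.

Lemma contact_den_neq0 s : contact_den s != 0. Proof. by rewrite gt_eqF. Qed.

Lemma nu_neq0 : nu != 0. Proof. by rewrite gt_eqF. Qed.

Lemma nup1_neq0 : 1 + nu != 0. Proof. by rewrite gt_eqF. Qed.

Lemma collinA x s m : collin x s m = collin s x m. Proof. by rewrite /collin; ring. Qed.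

Lemma collinC x s m : collin x s m = collin x m s. Proof. by rewrite /collin; ring. Qed.

Lemma chordC x m : chord x m = chord m x.
Proof. by rewrite /chord [mobl m * _]mulrC; congr (_ / _); ring. Qed.

(** The cross-multiplied difference of the two slopes is a polynomial in s with
    root m; the quotient by [m - s] is symmetric in the three abscissae. *)
Lemma chord_sub x s m :
  chord x s - chord x m
  = (m - s) * (collin x s m * (nu / (mobl x * mobl s * mobl m))).
Proof.
rewrite /chord.
move: (mobl_neq0 x) (mobl_neq0 s) (mobl_neq0 m); rewrite /collin /mobl => h1 h2 h3.
by field; rewrite h1 h2 h3.
Qed.

(** Limit case of [chord_sub] where one chord degenerates to the tangent at x. *)
Lemma lam_along_sub x m :
  lam_along x - chord x m = (m - x) * (collin x x m * (nu / (mobl x ^+ 2 * mobl m))).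
Proof.
rewrite /lam_along /chord; move: (mobl_neq0 x) (mobl_neq0 m).
by rewrite /collin /mobl => h1 h2; field; rewrite h1 h2.
Qed.

Lemma lam_cross_sub x m :
  chord x m - lam_cross x = (nu * m - x * contact_den m) / (mobl x * mobl m).
Proof.
rewrite /lam_cross /chord; move: (mobl_neq0 x) (mobl_neq0 m).
by rewrite /contact_den /mobl => h1 h2; field; rewrite h1 h2.
Qed.

Lemma lam_cross_diff x m :
  lam_cross m - lam_cross x
  = (m - x) * ((nu - (1 + nu) * x * m) * (2 / (mobl x * mobl m))).
Proof.
rewrite /lam_cross; move: (mobl_neq0 x) (mobl_neq0 m).
by rewrite /mobl => h1 h2; field; rewrite h1 h2.
Qed.

Lemma lam_along_cross_diff x :
  lam_along x - lam_cross x = (nu - (1 + nu) * x) * (2 * x ^+ 2 / mobl x ^+ 2).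
Proof.
rewrite /lam_cross /lam_along; move: (mobl_neq0 x).
by rewrite /mobl => h1; field; rewrite h1.
Qed.

(** Along the contact curve the tangency defect factors, and its only positive
    zero is the critical point [sCY] of [contact]: this is the double contact. *)
Lemma collin_contact x : collin x x (contact x)
  = (2 * (1 + nu) * x ^+ 2 - nu) * (mobl x / contact_den x).
Proof.
rewrite /collin /contact; move: (contact_den_neq0 x).
by rewrite /contact_den /mobl => h1; field; rewrite h1.
Qed.

(** A slow end state is never on the tangency curve, since the factor
    [2 * m - 1] is positive to the right of the umbilic point. *)
Lemma collin_contact_contact m :
  collin (contact m) (contact m) m
  = (2 * m - 1) * (nu ^+ 2 * mobl m / contact_den m ^+ 2).
Proof.
rewrite /collin /contact; move: (contact_den_neq0 m).
by rewrite /contact_den /mobl => h1; field; rewrite h1.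
Qed.

Lemma contact_diff s t :
  contact t - contact s
  = (t - s) * ((nu - 2 * (1 + nu) * s * t)
               * (nu / (contact_den s * contact_den t))).
Proof.
rewrite /contact; move: (contact_den_neq0 s) (contact_den_neq0 t).
by rewrite /contact_den => h1 h2; field; rewrite h1 h2.
Qed.

(** The equation [contact x = sU] has the roots [1 / 2] and [sU]. *)
Lemma contact_sub_sU x :
  contact x - sU
  = (1 - 2 * x) * ((1 + nu) * x - nu) * (nu / (contact_den x * (1 + nu))).
Proof.
rewrite /contact /sU; move: (contact_den_neq0 x) nup1_neq0.
by rewrite /contact_den => h1 h2; field; rewrite h1 h2.
Qed.

Lemma contact_sub_id x :
  contact x - x = x * ((nu - (1 + nu) * x) * (2 * x / contact_den x)).
Proof.
rewrite /contact; move: (contact_den_neq0 x).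
by rewrite /contact_den => h1; field; rewrite h1.
Qed.

(** With [lam_cross_diff] this orders [lam_cross x] and [lam_cross (contact x)]
    in the same way as x and [contact x]. *)
Lemma contact_mul_lt x : (1 + nu) * x * contact x < nu.
Proof.
rewrite -subr_gt0.
have -> : nu - (1 + nu) * x * contact x = nu * mobl x / contact_den x.
  rewrite /contact; move: (contact_den_neq0 x).
  by rewrite /contact_den /mobl => h1; field; rewrite h1.
by rewrite divr_gt0// mulr_gt0.
Qed.

Lemma contact_gt0 x : 0 < x -> 0 < contact x.
Proof. by move=> x0; rewrite divr_gt0// mulr_gt0. Qed.

Lemma lam_cross_chord_contact m : lam_cross (contact m) = chord (contact m) m.
Proof.
apply/eqP; rewrite eq_sym -subr_eq0 lam_cross_sub /contact divfK ?contact_den_neq0//.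
by rewrite subrr mul0r.
Qed.

Lemma lam_cross_le_chord x m : (lam_cross x <= chord x m) = (x <= contact m).
Proof.
rewrite -subr_ge0 lam_cross_sub pmulr_lge0 ?invr_gt0 ?mulr_gt0// subr_ge0.
by rewrite /contact ler_pdivlMr.
Qed.

Lemma lam_cross_lt_chord x m : (lam_cross x < chord x m) = (x < contact m).
Proof.
rewrite -subr_gt0 lam_cross_sub pmulr_lgt0 ?invr_gt0 ?mulr_gt0// subr_gt0.
by rewrite /contact ltr_pdivlMr.
Qed.

Lemma chord_eq_lam_cross x m : (chord x m == lam_cross x) = (x == contact m).
Proof.
by rewrite !eq_le leNgt lam_cross_lt_chord -leNgt lam_cross_le_chord andbC.
Qed.

Lemma chord_le_lam_cross x m : (chord x m <= lam_cross m) = (contact x <= m).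
Proof. by rewrite chordC !leNgt lam_cross_lt_chord. Qed.

Lemma chord_lt_lam_cross x m : (chord x m < lam_cross m) = (contact x < m).
Proof. by rewrite chordC !ltNge lam_cross_le_chord. Qed.

Lemma chord_le_lam_along x m : x < m ->
  (chord x m <= lam_along x) = (0 <= collin x x m).
Proof.
move=> xm; rewrite -subr_ge0 lam_along_sub pmulr_rge0; last by rewrite subr_gt0.
by rewrite pmulr_lge0// divr_gt0 ?mulr_gt0 ?exprn_gt0.
Qed.

Lemma chord_lt_lam_along x m : x < m ->
  (chord x m < lam_along x) = (0 < collin x x m).
Proof.
move=> xm; rewrite -subr_gt0 lam_along_sub pmulr_rgt0; last by rewrite subr_gt0.
by rewrite pmulr_lgt0// divr_gt0 ?mulr_gt0 ?exprn_gt0.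
Qed.

Lemma chord_eq_lam_along x m : x < m ->
  (chord x m == lam_along x) = (collin x x m == 0).
Proof.
move=> xm; rewrite [LHS]eq_le [lam_along x <= _]leNgt chord_le_lam_along//.
rewrite chord_lt_lam_along//.
rewrite -leNgt.
by rewrite [RHS]eq_le andbC.
Qed.

Lemma lam_along_lt_chord x m : x < m -> (lam_along m < chord x m) = (0 < collin x m m).
Proof.
move=> xm; rewrite -subr_lt0 chordC lam_along_sub nmulr_rlt0; last by rewrite subr_lt0.
rewrite pmulr_lgt0; last by rewrite divr_gt0 ?mulr_gt0 ?exprn_gt0.
by rewrite collinC collinA.
Qed.

Lemma chord_le_right x s m : s < m -> (chord x m <= chord x s) = (0 <= collin x s m).
Proof.
move=> sm; rewrite -subr_ge0 chord_sub pmulr_rge0; last by rewrite subr_gt0.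
by rewrite pmulr_lge0// divr_gt0 ?mulr_gt0.
Qed.

Lemma lam_cross_lt_contact x : 0 < x < sU -> lam_cross x < lam_cross (contact x).
Proof.
move=> /andP[x0]; rewrite /sU ltr_pdivlMr// mulrC => xU.
rewrite -subr_gt0 lam_cross_diff mulr_gt0 ?subr_gt0//.
  rewrite -subr_gt0 contact_sub_id.
  by rewrite !(mulr_gt0, subr_gt0, invr_gt0).
by rewrite mulr_gt0 ?subr_gt0 ?contact_mul_lt// divr_gt0 ?mulr_gt0.
Qed.

Lemma lam_cross_contact_lt x : 0 < x -> sU < x -> lam_cross (contact x) < lam_cross x.
Proof.
move=> x0; rewrite /sU ltr_pdivrMr// mulrC => xU.
rewrite -subr_gt0 lam_cross_diff mulr_gt0//.
  rewrite -oppr_lt0 opprB contact_sub_id pmulr_rlt0// pmulr_llt0 ?subr_lt0//.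
  by rewrite divr_gt0 ?mulr_gt0.
rewrite mulr_gt0 ?divr_gt0 ?mulr_gt0// subr_gt0.
by rewrite -mulrA [contact x * x]mulrC mulrA contact_mul_lt.
Qed.

Lemma contact_gt_id x : 0 < x < sU -> x < contact x.
Proof.
move=> /andP[x0]; rewrite /sU ltr_pdivlMr// mulrC => xU.
rewrite -subr_gt0 contact_sub_id.
by rewrite !(mulr_gt0, subr_gt0, invr_gt0).
Qed.

Lemma lam_cross_le_lam_along x : 0 <= x <= sU -> lam_cross x <= lam_along x.
Proof.
move=> /andP[x0]; rewrite /sU ler_pdivlMr// mulrC => xU.
rewrite -subr_ge0 lam_along_cross_diff mulr_ge0 ?subr_ge0//.
by apply: divr_ge0; [apply: mulr_ge0|]; rewrite ?sqr_ge0.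
Qed.

Lemma lam_along_le_lam_cross x : sU <= x -> lam_along x <= lam_cross x.
Proof.
rewrite /sU ler_pdivrMr// mulrC => xU.
rewrite -subr_le0 lam_along_cross_diff mulr_le0_ge0 ?subr_le0//.
by apply: divr_ge0; [apply: mulr_ge0|]; rewrite ?sqr_ge0.
Qed.

(** * The distinguished states *)

Lemma sU_gt0 : 0 < sU. Proof. by rewrite divr_gt0. Qed.

Lemma sU_lt1 : sU < 1.
Proof. by rewrite ltr_pdivrMr// mul1r; lra. Qed.

Lemma half_lt_sU : 1 / 2 < sU.
Proof. by rewrite ltr_pdivlMr//; move: nu1; lra. Qed.

Lemma sCY_gt0 : 0 < sCY.
Proof.
rewrite mulr_gt0 ?invr_gt0// sqrtr_gt0 divr_gt0 ?mulr_gt0//.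
by rewrite addrC.
Qed.

Lemma sCY_sq : 2 * (1 + nu) * sCY ^+ 2 = nu.
Proof.
rewrite /sCY exprMn sqr_sqrtr; last first.
  by rewrite ltW// divr_gt0 ?mulr_gt0 // addrC.
have h := nup1_neq0; rewrite (addrC nu 1); field; exact: h.
Qed.

Lemma sCY_lt_sU : sCY < sU.
Proof.
rewrite -(ltr_pXn2r (_ : 0 < 2)%N) ?nnegrE// ?ltW ?sCY_gt0 ?sU_gt0//.
have -> : sCY ^+ 2 = nu / (2 * (1 + nu)).
  by rewrite -[X in X / _]sCY_sq mulrC mulKf// mulf_neq0 ?nup1_neq0.
rewrite /sU exprMn exprVn ltr_pdivrMr ?mulr_gt0//.
have -> : nu ^+ 2 * ((1 + nu) ^+ 2)^-1 * (2 * (1 + nu)) = 2 * nu ^+ 2 / (1 + nu).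
  have := nup1_neq0 => h; field; exact: h.
rewrite ltr_pdivlMr//; move: nu1 => h; nra.
Qed.

Lemma contact_den_sCY : contact_den sCY = 2 * nu * (1 - sCY).
Proof. by rewrite /contact_den sCY_sq; ring. Qed.

Lemma sCY_lt1 : sCY < 1. Proof. exact: lt_trans sCY_lt_sU sU_lt1. Qed.

Lemma contact_sCY : contact sCY = sY.
Proof.
have c1 : 1 - sCY != 0 by rewrite subr_eq0 eq_sym lt_eqF// sCY_lt1.
have sq : Num.sqrt (2 * nu * (nu + 1)) = 2 * (1 + nu) * sCY.
  have -> : 2 * nu * (nu + 1) = (2 * (1 + nu) * sCY) ^+ 2.
    transitivity (2 * (1 + nu) * (2 * (1 + nu) * sCY ^+ 2)); last by ring.
    by rewrite sCY_sq; ring.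
  rewrite sqrtr_sqr ger0_norm//; apply: mulr_ge0; last exact: ltW sCY_gt0.
  by rewrite mulr_ge0// ltW.
rewrite /sY sq /contact contact_den_sCY.
have n2 : nu + 2 != 0 by rewrite gt_eqF//; move: nu1; lra.
apply/eqP; rewrite eqr_div ?mulf_neq0 ?nu_neq0//; apply/eqP.
have h := sCY_sq.
have -> : (nu + 2 * (1 + nu) * sCY) * (2 * nu * (1 - sCY)) =
  2 * nu * (nu + 2 * (1 + nu) * sCY - nu * sCY - 2 * (1 + nu) * sCY ^+ 2) by ring.
by rewrite h; ring.
Qed.

(** [sCY] is the critical point of [contact]: the sign of the increment is that of
    [nu - 2 * (1 + nu) * s * t], and [2 * (1 + nu) * sCY ^+ 2 = nu]. *)
Lemma contact_lt s t : sCY <= s -> s < t -> contact t < contact s.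
Proof.
move=> cs st; rewrite -subr_lt0 contact_diff pmulr_rlt0; last by rewrite subr_gt0.
rewrite pmulr_llt0; last by rewrite divr_gt0 ?mulr_gt0.
rewrite subr_lt0 -[ltLHS]sCY_sq -[ltRHS]mulrA ltr_pM2l ?mulr_gt0//.
have c0 := sCY_gt0.
rewrite expr2; apply: (@le_lt_trans _ _ (sCY * s)); first by rewrite ler_pM2l.
by rewrite mulrC ltr_pM2l ?(lt_le_trans c0 cs)// (le_lt_trans cs).
Qed.

Lemma contact_le s t : sCY <= s -> s <= t -> contact t <= contact s.
Proof.
by move=> cs; rewrite le_eqVlt => /predU1P[->//|/(contact_lt cs)/ltW].
Qed.

Lemma contact_lt_sCY s : 0 < s -> s != sCY -> contact s < sY.
Proof.
move=> s0 sc; rewrite -contact_sCY -subr_lt0 contact_diff.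
have -> : nu - 2 * (1 + nu) * sCY * s = - (2 * (1 + nu) * sCY) * (s - sCY).
  by rewrite -[X in X - _]sCY_sq; ring.
set d := nu / (contact_den sCY * contact_den s).
have -> : (s - sCY) * (- (2 * (1 + nu) * sCY) * (s - sCY) * d)
  = - ((s - sCY) ^+ 2 * (2 * (1 + nu) * sCY * d)) by ring.
rewrite oppr_lt0; apply: mulr_gt0; first by rewrite exprn_even_gt0//= subr_eq0.
apply: mulr_gt0; last by rewrite divr_gt0 ?mulr_gt0.
by apply: mulr_gt0; [rewrite mulr_gt0|exact: sCY_gt0].
Qed.

Lemma contact_le_sY s : 0 < s -> contact s <= sY.
Proof.
move=> s0; have [->|sc] := eqVneq s sCY; first by rewrite contact_sCY.
exact/ltW/contact_lt_sCY.
Qed.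

Lemma contact_sU : contact sU = sU.
Proof.
apply/eqP; rewrite -subr_eq0 contact_sub_id /sU [(1 + nu) * _]mulrC divfK ?nup1_neq0//.
by rewrite subrr mul0r mulr0.
Qed.

Lemma sU_lt_sY : sU < sY.
Proof. by rewrite -contact_sU contact_lt_sCY ?sU_gt0// gt_eqF// sCY_lt_sU. Qed.

Lemma contact_lt_sU m : sU < m -> contact m < sU.
Proof. by move=> h; rewrite -[ltRHS]contact_sU contact_lt// ltW// sCY_lt_sU. Qed.

Lemma contact1 : contact 1 = sD1.
Proof. by rewrite /contact /sD1 mulr1; congr (_ / _); rewrite /contact_den; ring. Qed.

Lemma sD1_le_contact m : sU < m <= 1 -> sD1 <= contact m.
Proof.
move=> /andP[um m1]; rewrite -contact1 contact_le// (le_trans (ltW sCY_lt_sU))//.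
exact: ltW.
Qed.

Lemma sD1_lt_sU : sD1 < sU.
Proof. by rewrite -contact1 contact_lt_sU// sU_lt1. Qed.

Lemma collin_far_le x m m' : 0 <= x <= 1 -> m <= m' -> collin x x m <= collin x x m'.
Proof.
move=> /andP[x0 x1] mm; rewrite -subr_ge0.
have -> : collin x x m' - collin x x m = 2 * (1 + nu) * (x * (1 - x) * (m' - m)).
  by rewrite /collin; ring.
by rewrite !mulr_ge0 ?subr_ge0// ?(ltW nup1_gt0).
Qed.

Lemma collin_near_le x s s' m : 0 <= x <= 1 -> 0 <= m <= 1 -> s <= s' ->
  collin x s m <= collin x s' m.
Proof.
move=> /andP[x0 x1] /andP[m0 m1] ss; rewrite -subr_ge0.
have -> : collin x s' m - collin x s m
    = (1 + nu) * ((x * (1 - m) + m * (1 - x)) * (s' - s)).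
  by rewrite /collin; ring.
apply: mulr_ge0; first exact: ltW.
apply: mulr_ge0; last by rewrite subr_ge0.
by apply: addr_ge0; apply: mulr_ge0; rewrite ?subr_ge0.
Qed.

Lemma collin_near_lt x s s' m : 0 < x <= 1 -> 0 <= m <= 1 -> x < m -> s < s' ->
  collin x s m < collin x s' m.
Proof.
move=> /andP[x0 x1] /andP[m0 m1] xm ss; rewrite -subr_gt0.
have -> : collin x s' m - collin x s m
    = (1 + nu) * ((x * (1 - m) + m * (1 - x)) * (s' - s)).
  by rewrite /collin; ring.
rewrite mulr_gt0// mulr_gt0 ?subr_gt0// ltr_wpDl ?mulr_ge0 ?subr_ge0//.
  exact: ltW.
by rewrite mulr_gt0 ?subr_gt0 ?(lt_trans x0)// (lt_le_trans xm).
Qed.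

(** Hence the tangency equation [collin x x m = 0] has one root x at most in the
    unit interval, for given m. *)
Lemma collin_diag_lt u v m : 0 <= u -> u < v -> v <= 1 -> 0 < m <= 1 ->
  collin u u m < collin v v m.
Proof.
move=> u0 uv v1 /andP[m0 m1]; rewrite -subr_gt0.
have -> : collin v v m - collin u u m
    = (1 + nu) * ((v - u) * ((u + v) * (1 - m) + m * (2 - (u + v)))).
  by rewrite /collin; ring.
rewrite mulr_gt0// mulr_gt0 ?subr_gt0// ltr_wpDl ?mulr_ge0 ?subr_ge0//.
  by rewrite addr_ge0// (le_trans u0)// ltW.
by rewrite mulr_gt0 ?subr_gt0//; lra.
Qed.

Lemma collin_diag_le u v m : 0 <= u -> u <= v -> v <= 1 -> 0 < m <= 1 ->
  collin u u m <= collin v v m.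
Proof.
move=> u0; rewrite le_eqVlt => /predU1P[->//|uv] v1 m01.
exact/ltW/collin_diag_lt.
Qed.

(** At the double contact the chord is tangent at its left end and has the
    transversal speed of its right end. *)
Lemma collin_sCY : collin sCY sCY sY = 0.
Proof. by rewrite -contact_sCY collin_contact sCY_sq subrr mul0r. Qed.

Lemma collin_contact_ge0 x : 0 <= x -> (0 <= collin x x (contact x)) = (sCY <= x).
Proof.
move=> x0; rewrite collin_contact pmulr_lge0 ?divr_gt0// subr_ge0 -[leLHS]sCY_sq.
by rewrite ler_pM2l ?mulr_gt0// ler_pXn2r// nnegrE// ltW// sCY_gt0.
Qed.

Lemma collin_contact_gt0 x : 0 <= x -> (0 < collin x x (contact x)) = (sCY < x).
Proof.
move=> x0; rewrite collin_contact pmulr_lgt0 ?divr_gt0// subr_gt0 -[ltLHS]sCY_sq.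
by rewrite ltr_pM2l ?mulr_gt0// ltr_pXn2r// nnegrE// ltW// sCY_gt0.
Qed.

Let q := Num.sqrt (nu + 1).
Let q_gt1 : 1 < q.
Proof. by rewrite -sqrtr1 ltr_sqrt; move: nu1; lra. Qed.

Let q_sq : q ^+ 2 = 1 + nu.
Proof. by rewrite sqr_sqrtr addrC// ltW. Qed.

Lemma sD2_gt0 : 0 < sD2.
Proof. by rewrite divr_gt0 ?subr_gt0 ?(lt_trans ltr01). Qed.

Lemma sD2E : 1 - sD2 = q^-1.
Proof.
have q0 : q != 0 by rewrite gt_eqF// (lt_trans ltr01).
by rewrite /sD2 -/q; field.
Qed.

Lemma collin_sD2 : collin sD2 sD2 1 = 0.
Proof.
have q0 : q != 0 by rewrite gt_eqF// (lt_trans ltr01).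
have -> : collin sD2 sD2 1 = 1 - (1 + nu) * (1 - sD2) ^+ 2 by rewrite /collin; ring.
by rewrite sD2E -q_sq exprVn divff ?subrr// expf_neq0.
Qed.

Lemma sD2_lt1 : sD2 < 1.
Proof. by rewrite -subr_gt0 sD2E invr_gt0 (lt_trans ltr01). Qed.

(** * Tangent chords *)

Lemma tangent_den_gt0 m : 0 < (1 + nu) * m + Num.sqrt ((1 + nu) * mobl m).
Proof.
have [m0|m0] := ltP 0 m; first by rewrite addr_gt0 ?mulr_gt0 ?sqrtr_gt0// mulr_gt0.
rewrite -ltrBlDl sub0r -[ltLHS]ger0_norm; last first.
  by rewrite oppr_ge0 pmulr_rle0.
rewrite -sqrtr_sqr ltr_sqrt ?mulr_gt0// -subr_gt0.
have -> : (1 + nu) * mobl m - (- ((1 + nu) * m)) ^+ 2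
    = (1 + nu) * (nu * (1 - 2 * m)) by rewrite /mobl; ring.
by rewrite !mulr_gt0// subr_gt0; lra.
Qed.

Lemma tangent_gt0 m : 0 < tangent m.
Proof. by rewrite divr_gt0// tangent_den_gt0. Qed.

Lemma collin_tangent m : collin (tangent m) (tangent m) m = 0.
Proof.
rewrite /tangent; have := tangent_den_gt0 m.
set r := Num.sqrt _ => d0.
have rr : r ^+ 2 = (1 + nu) * mobl m by rewrite sqr_sqrtr// ltW// mulr_gt0.
have dn0 : (1 + nu) * m + r != 0 by rewrite gt_eqF.
set d := (1 + nu) * m + r in d0 dn0 *.
have -> : collin (nu / d) (nu / d) m
  = nu * ((1 + nu) * nu * (1 - 2 * m) + 2 * (1 + nu) * m * d - d ^+ 2) / d ^+ 2.
  by rewrite /collin; field.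
have -> : d ^+ 2 = 2 * (1 + nu) * m * d - ((1 + nu) * m) ^+ 2 + r ^+ 2.
  by rewrite /d; ring.
by rewrite rr /mobl [X in X / _](_ : _ = 0) ?mul0r//; ring.
Qed.

Lemma tangent_lt1 m : sU <= m -> tangent m < 1.
Proof.
move=> um; rewrite ltr_pdivrMr ?tangent_den_gt0// mul1r ltr_pwDr//.
  by rewrite sqrtr_gt0 mulr_gt0.
by rewrite mulrC -ler_pdivrMr.
Qed.

Lemma tangent_unique x m : 0 <= x <= 1 -> sU <= m <= 1 -> collin x x m = 0 ->
  x = tangent m.
Proof.
move=> /andP[x0 x1] /andP[um m1] xm.
have m0 : 0 < m by exact: lt_le_trans sU_gt0 um.
have [h|h|//] := ltgtP x (tangent m).
- have := @collin_diag_lt x (tangent m) m x0 h (ltW (tangent_lt1 um)).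
  by rewrite m0 m1 xm collin_tangent ltxx => /(_ isT).
- have := @collin_diag_lt (tangent m) x m (ltW (tangent_gt0 m)) h x1.
  by rewrite m0 m1 xm collin_tangent ltxx => /(_ isT).
Qed.

Lemma collin_far_lt x m m' : 0 < x < 1 -> m < m' -> collin x x m < collin x x m'.
Proof.
move=> /andP[x0 x1] mm; rewrite -subr_gt0.
have -> : collin x x m' - collin x x m = 2 * (1 + nu) * (x * (1 - x) * (m' - m)).
  by rewrite /collin; ring.
by rewrite !mulr_gt0 ?subr_gt0.
Qed.

(** Otherwise monotonicity of [collin] would make [collin sCY sCY m] nonpositive,
    although it vanishes already at the smaller value [m = sY]. *)
Lemma tangent_lt_sCY m : sY < m <= 1 -> tangent m < sCY.
Proof.
move=> /andP[ym m1]; rewrite ltNge; apply/negP => h.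
have m0 : 0 < m by exact: (lt_trans (lt_trans sU_gt0 sU_lt_sY) ym).
have um : sU <= m by rewrite ltW// (lt_trans sU_lt_sY ym).
have := @collin_diag_le sCY (tangent m) m (ltW sCY_gt0) h (ltW (tangent_lt1 um)).
rewrite m0 m1 collin_tangent leNgt => /(_ isT)/negP; apply.
by rewrite -collin_sCY collin_far_lt// sCY_gt0 sCY_lt1.
Qed.

Lemma sD2_le_tangent m : sU <= m <= 1 -> sD2 <= tangent m.
Proof.
move=> /andP[um m1]; rewrite leNgt; apply/negP => h.
have m0 : 0 < m by exact: lt_le_trans sU_gt0 um.
have := collin_diag_lt (ltW (tangent_gt0 m)) h (ltW sD2_lt1).
move=> /(_ m); rewrite m0 m1 collin_tangent => /(_ isT).
rewrite ltNge -[X in _ <= X]collin_sD2 collin_far_le//.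
by rewrite !ltW ?sD2_gt0 ?sD2_lt1.
Qed.

(** The tangency defect to D vanishes at [sD2] and is positive at
    [sD1 = contact 1]. *)
Lemma sD2_lt_sD1 : sD2 < sD1.
Proof.
have t0 : 0 < collin sD1 sD1 1.
  rewrite -contact1 collin_contact_contact; apply: mulr_gt0; first by lra.
  by rewrite divr_gt0 ?mulr_gt0 ?exprn_gt0.
rewrite ltNge; apply/negP => h.
have d0 : 0 <= sD1 by rewrite -contact1 ltW// contact_gt0.
have := collin_diag_le d0 h (ltW sD2_lt1).
by move=> /(_ 1); rewrite lexx ltr01 collin_sD2 leNgt t0 => /(_ isT).
Qed.

Hypothesis nu8 : nu <= 8.

(** The bound on the viscosity ratio is exactly [sCY <= 2 / 3], that is,
    [contact sCY <= 1]. *)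
Lemma sY_le1 : sY <= 1.
Proof.
have c23 : sCY <= 2 / 3.
  rewrite -(ler_pXn2r (_ : 0 < 2)%N) ?nnegrE//; last exact: ltW sCY_gt0.
  have k2 : 0 < 2 * (1 + nu) by rewrite mulr_gt0.
  by rewrite -(ler_pM2l k2) sCY_sq; move: nu8; lra.
rewrite -contact_sCY /contact contact_den_sCY ler_pdivrMr; last first.
  by rewrite !mulr_gt0// subr_gt0 sCY_lt1.
rewrite mul1r (_ : 2 * nu * (1 - sCY) = nu * (2 * (1 - sCY))); last by ring.
by rewrite ler_pM2l//; move: c23; lra.
Qed.

Lemma sD2_le_sCY : sD2 <= sCY.
Proof.
rewrite leNgt; apply/negP => h.
have := collin_diag_lt (ltW sCY_gt0) h (ltW sD2_lt1).
move=> /(_ 1); rewrite lexx ltr01 collin_sD2 => /(_ isT).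
rewrite ltNge -[X in X <= _]collin_sCY collin_far_le// ?sY_le1//.
by rewrite !ltW ?sCY_gt0 ?sCY_lt1.
Qed.

Lemma sD2_lt_sU : sD2 < sU.
Proof. exact: le_lt_trans sD2_le_sCY sCY_lt_sU. Qed.

(** * Extreme speeds on the two representations of the surface *)

Definition lower_plus m : R := lam_cross (contact m).
Definition upper_plus m : R := Num.min (lam_cross m) (chord (tangent m) m).
Definition lower_minus u : R := Num.max (chord u 1) (lam_cross u).
Definition upper_minus u : R := Num.min (lam_along u) (lam_cross (contact u)).

(** Up to [sY] the transversal speed of m is the binding constraint.  If the
    tangent chord were slower, its left end would lie left of [sCY] by the sign
    in [collin_contact], and then [collin sCY sCY m] would be positive. *)
Lemma upper_plus_low m : sU <= m <= sY -> upper_plus m = lam_cross m.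
Proof.
move=> /andP[um my]; apply/min_idPl.
have m1 : m <= 1 by exact: le_trans my sY_le1.
have m0 : 0 < m by exact: lt_le_trans sU_gt0 um.
rewrite leNgt chord_lt_lam_cross; apply/negP => h.
have t0 := tangent_gt0 m.
have t01 : 0 <= tangent m <= 1 by rewrite !ltW ?tangent_lt1.
have tc : tangent m < sCY.
  rewrite ltNge -(collin_contact_ge0 (ltW t0)) -ltNge -(collin_tangent m) collin_far_lt//.
  by rewrite t0 tangent_lt1.
have := collin_diag_lt (ltW t0) tc (ltW sCY_lt1).
move=> /(_ m); rewrite m0 m1 collin_tangent => /(_ isT).
rewrite ltNge -[X in _ <= X]collin_sCY collin_far_le//.
by rewrite !ltW ?sCY_gt0 ?sCY_lt1.
Qed.

(** Beyond [sY], the maximum of [contact], every chord is slower than the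
    transversal speed of m. *)
Lemma upper_plus_high m : sY < m -> upper_plus m = chord (tangent m) m.
Proof.
move=> ym; apply/min_idPr; rewrite chord_le_lam_cross.
by rewrite (le_trans (contact_le_sY (tangent_gt0 m)))// ltW.
Qed.

Lemma collin_contact_contact_gt0 m : sU < m -> 0 < collin (contact m) (contact m) m.
Proof.
move=> um; rewrite collin_contact_contact mulr_gt0//; last first.
  by rewrite divr_gt0 ?mulr_gt0 ?exprn_gt0.
by move: half_lt_sU um; lra.
Qed.

Lemma tangent_lt_contact m : sU < m <= 1 -> tangent m < contact m.
Proof.
move=> /andP[um m1]; rewrite ltNge; apply/negP => h.
have m0 : 0 < m by exact: lt_trans sU_gt0 um.
have := collin_diag_le (ltW (contact_gt0 m0)) h (ltW (tangent_lt1 (ltW um))).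
move=> /(_ m); rewrite m0 m1 collin_tangent => /(_ isT).
by rewrite leNgt collin_contact_contact_gt0.
Qed.

Lemma lam_cross_sU : lam_cross sU = 2.
Proof.
rewrite /lam_cross.
have E0 : mobl sU = nu / (1 + nu).
  by rewrite /mobl /sU; have := nup1_neq0 => h; field.
have s0 : sU != 0 by rewrite gt_eqF// sU_gt0.
by rewrite E0 -/sU mulfK.
Qed.

Lemma lower_plus_sU : lower_plus sU = 2.
Proof. by rewrite /lower_plus contact_sU lam_cross_sU. Qed.

Lemma upper_plus_sU : upper_plus sU = 2.
Proof. by rewrite upper_plus_low ?lam_cross_sU// lexx ltW// sU_lt_sY. Qed.

(** Chords to m get slower as the left end moves right of the point of
    tangency, and the slow end state lies to the right of it. *)
Lemma lower_plus_le_upper_plus m : sU <= m <= 1 -> lower_plus m <= upper_plus m.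
Proof.
move=> /andP[]; rewrite le_eqVlt => /predU1P[<- _|um m1].
  by rewrite lower_plus_sU upper_plus_sU.
have m0 : 0 < m := lt_trans sU_gt0 um.
rewrite /lower_plus /upper_plus le_min ltW ?lam_cross_contact_lt//=.
have tP : tangent m < contact m by rewrite tangent_lt_contact// um.
rewrite lam_cross_chord_contact ![chord _ m]chordC chord_le_right//.
have -> : collin m (tangent m) (contact m) = collin (tangent m) (contact m) m.
  by rewrite collinA collinC.
rewrite -[leLHS](collin_tangent m) collin_near_le ?m1 ?(ltW m0) ?(ltW tP)//.
by rewrite !ltW ?tangent_gt0 ?tangent_lt1// ltW.
Qed.

Lemma lower_minus_low u : u <= sD1 -> lower_minus u = chord u 1.
Proof. by move=> h; apply/max_idPl; rewrite lam_cross_le_chord contact1. Qed.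

Lemma lower_minus_high u : sD1 <= u -> lower_minus u = lam_cross u.
Proof.
by move=> h; apply/max_idPr; rewrite leNgt lam_cross_lt_chord contact1 -leNgt.
Qed.

Lemma upper_minus_low u : 0 < u <= sCY -> upper_minus u = lam_along u.
Proof.
move=> /andP[u0 uc]; apply/min_idPl.
have uP : u < contact u by rewrite contact_gt_id// u0 (le_lt_trans uc)// sCY_lt_sU.
rewrite lam_cross_chord_contact chordC leNgt chord_lt_lam_along//.
rewrite collin_contact_gt0 ?ltW//.
by rewrite -leNgt.
Qed.

Lemma upper_minus_high u : sCY <= u <= sU -> upper_minus u = lam_cross (contact u).
Proof.
move=> /andP[cu]; rewrite le_eqVlt => /predU1P[->|uU].
  by apply/min_idPr; rewrite contact_sU lam_cross_le_lam_along// lexx ltW// sU_gt0.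
have u0 : 0 < u by exact: lt_le_trans sCY_gt0 cu.
apply/min_idPr; rewrite lam_cross_chord_contact chordC chord_le_lam_along.
  by rewrite collin_contact_ge0// ltW.
by rewrite contact_gt_id// u0.
Qed.

Lemma lower_minus_sU : lower_minus sU = 2.
Proof. by rewrite lower_minus_high ?lam_cross_sU// ltW// sD1_lt_sU. Qed.

Lemma upper_minus_sU : upper_minus sU = 2.
Proof. by rewrite upper_minus_high ?contact_sU ?lam_cross_sU// lexx ltW// sCY_lt_sU. Qed.

Lemma lam_along_sD2 : lam_along sD2 = chord sD2 1.
Proof. by apply/esym/eqP; rewrite chord_eq_lam_along ?sD2_lt1// collin_sD2. Qed.

Lemma lower_minus_eq_upper_minus_sD2 : lower_minus sD2 = upper_minus sD2.
Proof.
rewrite lower_minus_low ?ltW ?sD2_lt_sD1// upper_minus_low ?lam_along_sD2//.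
by rewrite sD2_gt0 sD2_le_sCY.
Qed.

Lemma collin_diag1_ge0 u : sD2 <= u <= 1 -> 0 <= collin u u 1.
Proof.
move=> /andP[du u1]; rewrite -[leLHS]collin_sD2 collin_diag_le ?ltr01 ?lexx//.
exact: ltW sD2_gt0.
Qed.

(** Right of the point of tangency [sD2], chords to D get slower as the left end
    moves right. *)
Lemma chord1_le u w : sD2 <= u -> u <= w -> w <= 1 -> chord w 1 <= chord u 1.
Proof.
move=> du; rewrite le_eqVlt => /predU1P[->//|uw] w1.
have u1 : u <= 1 by rewrite (le_trans (ltW uw)).
rewrite chordC [chord u 1]chordC chord_le_right//.
have -> : collin 1 u w = collin u w 1 by rewrite collinA collinC.
rewrite (@le_trans _ _ (collin u u 1)) ?collin_diag1_ge0 ?du//.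
apply: collin_near_le; rewrite ?u1 ?ler01 ?lexx ?(ltW uw)//.
by rewrite (le_trans _ du)// ltW// sD2_gt0.
Qed.

Lemma lower_minus_le_upper_minus u : sD2 <= u <= sU -> lower_minus u <= upper_minus u.
Proof.
move=> /andP[du]; rewrite le_eqVlt => /predU1P[->|uU].
  by rewrite lower_minus_sU upper_minus_sU.
have u0 : 0 < u := lt_le_trans sD2_gt0 du.
have u1 : u < 1 := lt_trans uU sU_lt1.
have t0 : 0 <= collin u u 1 by rewrite collin_diag1_ge0// du ltW.
have uP : u < contact u by rewrite contact_gt_id// u0.
rewrite /lower_minus /upper_minus le_min !ge_max; apply/andP; split; apply/andP; split.
- by rewrite chord_le_lam_along.
- by rewrite lam_cross_le_lam_along// !ltW.
- rewrite lam_cross_chord_contact [chord (contact u) u]chordC.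
  have [->//|P1] := eqVneq (contact u) 1.
  have P_lt1 : contact u < 1.
    by rewrite lt_neqAle P1 (le_trans (contact_le_sY u0)) ?sY_le1.
  rewrite chord_le_right// (le_trans t0)// collin_near_le ?ler01 ?lexx ?(ltW uP)//.
  by rewrite !ltW.
- by rewrite ltW// lam_cross_lt_contact// u0.
Qed.

(** * Continuity of the reduced quantities *)

Lemma continuous_add (f g : R -> R) :
  continuous f -> continuous g -> continuous (fun x => f x + g x).
Proof. by move=> cf cg x; exact: cvgD (cf x) (cg x). Qed.

Lemma continuous_opp (f : R -> R) : continuous f -> continuous (fun x => - f x).
Proof. by move=> cf x; exact: cvgN (cf x). Qed.

Lemma continuous_mul (f g : R -> R) :
  continuous f -> continuous g -> continuous (fun x => f x * g x).
Proof. by move=> cf cg x; exact: cvgM (cf x) (cg x). Qed.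

Lemma continuous_inv (f : R -> R) :
  (forall x, f x != 0) -> continuous f -> continuous (fun x => (f x)^-1).
Proof. by move=> f0 cf x; exact: cvgV (f0 x) (cf x). Qed.

Lemma continuous_exp (f : R -> R) n : continuous f -> continuous (fun x => f x ^+ n).
Proof.
by move=> cf x; exact: (continuous_comp (cf x) (@exprn_continuous _ n (f x))).
Qed.

Lemma continuous_cst (a : R) : continuous (fun _ : R => a).
Proof. by move=> x; exact: cst_continuous. Qed.

Lemma continuous_id : continuous (fun x : R => x).
Proof. by move=> x; exact: cvg_id. Qed.

Ltac prove_continuous := lazymatch goal with
  | |- continuous (fun x => @Algebra.add _ (@?f x) (@?g x)) =>
      apply: (@continuous_add f g); prove_continuous
  | |- continuous (fun x => @Algebra.opp _ (@?f x)) =>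
      apply: (@continuous_opp f); prove_continuous
  | |- continuous (fun x => @GRing.mul _ (@?f x) (@?g x)) =>
      apply: (@continuous_mul f g); prove_continuous
  | |- continuous (fun x => @GRing.exp _ (@?f x) ?n) =>
      apply: (@continuous_exp f n); prove_continuous
  | |- continuous (fun _ => ?a) => exact: (@continuous_cst a)
  | |- continuous (fun x => x) => exact: continuous_id
  | _ => idtac
  end.

Lemma mobl_continuous : continuous mobl.
Proof. by rewrite /mobl; prove_continuous. Qed.

Lemma lam_cross_continuous : continuous lam_cross.
Proof.
by rewrite /lam_cross; prove_continuous;
  exact: (continuous_inv mobl_neq0 mobl_continuous).
Qed.

Lemma lam_along_continuous : continuous lam_along.
Proof.
rewrite /lam_along; prove_continuous; apply: (@continuous_inv (fun s => mobl s ^+ 2)).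
  by move=> x; rewrite expf_neq0// mobl_neq0.
by prove_continuous; exact: mobl_continuous.
Qed.

Lemma contact_continuous : continuous contact.
Proof.
by rewrite /contact; prove_continuous; apply: (continuous_inv contact_den_neq0);
  rewrite /contact_den; prove_continuous.
Qed.

Lemma chord_comp_continuous f g : continuous f -> continuous g ->
  continuous (fun t => chord (f t) (g t)).
Proof.
move=> cf cg; rewrite /chord; prove_continuous => //.
apply: (@continuous_inv (fun t => mobl (f t) * mobl (g t))).
  by move=> x; rewrite mulf_neq0 ?mobl_neq0.
by rewrite /mobl; prove_continuous.
Qed.

Lemma tangent_continuous : continuous tangent.
Proof.
rewrite /tangent; prove_continuous.
apply: (@continuous_inv (fun m => (1 + nu) * m + Num.sqrt ((1 + nu) * mobl m))).
  by move=> m; rewrite gt_eqF// tangent_den_gt0.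
prove_continuous => m; have cE : continuous (fun m => (1 + nu) * mobl m).
  by prove_continuous; exact: mobl_continuous.
exact: (continuous_comp (cE m) (@sqrt_continuous _ _)).
Qed.

(** * Left states joined to a given right state *)

(** The three conditions say that the speed of the chord from u to m is at most
    [lam_cross m], at most [lam_along u], and at least [lam_cross u]. *)
Definition joinable u m : bool :=
  [&& contact u <= m, 0 <= collin u u m & u <= contact m].

(** For [1 / 2 < u] already [contact u] exceeds [sU].  For smaller u the tangency
    defect at [m = sU] is negative, because u is then left of [1 - u]. *)
Lemma joinable_gt_sU u m : 0 < u -> joinable u m -> u < sU -> sU < m.
Proof.
move=> u0 /and3P[Pm tm _] uU; rewrite ltNge; apply/negP => mU.
have [h|h] := ltP (1 / 2) u.
  have : contact u <= sU by exact: le_trans Pm mU.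
  apply/negP; rewrite -ltNge -subr_gt0 contact_sub_sU.
  apply: mulr_gt0; last by rewrite divr_gt0 ?mulr_gt0.
  rewrite nmulr_rgt0; last by lra.
  by rewrite subr_lt0 mulrC -ltr_pdivlMr.
have u01 : 0 <= u <= 1 by rewrite ltW//= (le_trans h)//; lra.
have := le_trans tm (collin_far_le u01 mU); apply/negP; rewrite -ltNge.
have -> : collin u u sU = (2 * u - 1) - (nu - 1) * (1 - u) ^+ 2.
  by rewrite /collin /sU; have := nup1_neq0 => hn; field.
have : 0 < (nu - 1) * (1 - u) ^+ 2.
  by rewrite mulr_gt0 ?exprn_gt0 ?subr_gt0//; lra.
by move: h; lra.
Qed.

(** For fixed u the speed is a decreasing continuous function of m as long as m
    is joinable, so the attained speeds form an interval; its ends are the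
    speeds at the constraints [m <= 1], [u <= contact m], [contact u <= m] and
    [0 <= collin u u m].  The intermediate value theorem on [[contact u, 1]]
    gives m for a prescribed speed, and the bounds on the speed give back the
    remaining constraints. *)
Lemma speed_range_minus u v :
  (sD2 <= u < sU /\ lower_minus u <= v <= upper_minus u) <->
  exists2 m, sU < m <= 1 & [/\ sD2 <= u, u < sU, joinable u m & v = chord u m].
Proof.
split.
- move=> [/andP[du uU]]; rewrite /lower_minus /upper_minus ge_max le_min.
  move=> /andP[/andP[v1 vA] /andP[vB vP]].
  have u0 := lt_le_trans sD2_gt0 du.
  have uP : u < contact u by rewrite contact_gt_id// u0.
  have P1 : contact u <= 1 by rewrite (le_trans (contact_le_sY u0))// sY_le1.
  have : exists2 m, m \in `[contact u, 1] & chord u m = v.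
    apply: IVT => //.
      apply: continuous_subspaceT; apply: chord_comp_continuous.
        exact: continuous_cst.
      exact: continuous_id.
    rewrite ge_min le_max v1 [chord u (contact u)]chordC.
    by rewrite -lam_cross_chord_contact vP orbT.
  case=> m; rewrite in_itv/= => /andP[Pm m1] mv.
  have um : u < m by exact: lt_le_trans uP Pm.
  have tm : 0 <= collin u u m by rewrite -chord_le_lam_along// mv.
  have ju : joinable u m.
    by rewrite /joinable Pm tm/= -lam_cross_le_chord mv.
  by exists m; rewrite ?(joinable_gt_sU u0 ju).
- move=> [m /andP[um m1] [du uU /and3P[Pm tm mP] ->]].
  have u0 := lt_le_trans sD2_gt0 du.
  have u01 : 0 <= u <= 1 by rewrite !ltW// (lt_trans uU) ?sU_lt1.
  have m0 : 0 < m by exact: lt_trans sU_gt0 um.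
  have uP : u < contact u by rewrite contact_gt_id// u0.
  have m01 : 0 <= m <= 1 by rewrite m1 ltW.
  rewrite du uU; split=> //; rewrite /lower_minus /upper_minus ge_max le_min.
  rewrite lam_cross_le_chord mP chord_le_lam_along ?(lt_trans uU)// tm/= andbT.
  apply/andP; split.
    have [->//|mn1] := eqVneq m 1.
    rewrite chord_le_right ?lt_neqAle ?mn1// (le_trans tm)// [leRHS]collinC.
    by apply: collin_near_le; rewrite ?ler01 ?lexx// ltW// (lt_trans uU) ?sU_lt1.
  rewrite lam_cross_chord_contact [chord (contact u) u]chordC.
  have [->//|mn] := eqVneq (contact u) m.
  rewrite chord_le_right ?lt_neqAle ?mn// (le_trans tm)//.
  by apply: collin_near_le; rewrite // ltW.
Qed.

(** The parameter of the fast end state of m.  For [m <= sY] there are two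
    solutions of [contact x = m], and the one on the decreasing branch is
    meant. *)
Definition fast_end x m : bool :=
  if m <= sY then (sCY <= x) && (contact x == m) else x == tangent m.

Lemma tangent_sY : tangent sY = sCY.
Proof.
apply/esym/tangent_unique; rewrite ?collin_sCY//.
  by rewrite !ltW ?sCY_gt0 ?sCY_lt1.
by rewrite sY_le1 ltW// sU_lt_sY.
Qed.

Lemma tangent1 : tangent 1 = sD2.
Proof.
apply/esym/tangent_unique; rewrite ?collin_sD2//.
  by rewrite !ltW ?sD2_gt0 ?sD2_lt1.
by rewrite lexx ltW// sU_lt1.
Qed.

Lemma contact_onto_slow t : sD1 <= t < sU -> exists2 m, sU < m <= 1 & contact m = t.
Proof.
move=> /andP[dt tU].
have [||m] := @IVT R contact sU 1 t (ltW sU_lt1).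
- exact/continuous_subspaceT/contact_continuous.
- by rewrite contact_sU contact1 ge_min le_max dt (ltW tU) orbT.
rewrite in_itv/= => /andP[um m1] mt; exists m => //.
rewrite m1 andbT lt_neqAle um andbT; apply/eqP => mU.
by move: tU; rewrite -mt -mU contact_sU ltxx.
Qed.

Lemma contact_onto_fast m : sU < m <= sY -> exists2 x, sCY <= x < sU & contact x = m.
Proof.
move=> /andP[um my].
have [||x] := @IVT R contact sCY sU m (ltW sCY_lt_sU).
- exact/continuous_subspaceT/contact_continuous.
- by rewrite contact_sU contact_sCY ge_min le_max my (ltW um) orbT.
rewrite in_itv/= => /andP[cx xU] xm; exists x => //.
rewrite cx/= lt_neqAle xU andbT; apply/eqP => xE.
by move: um; rewrite -xm xE contact_sU ltxx.
Qed.

Lemma tangent_onto x : sD2 <= x < sCY -> exists2 m, sY < m <= 1 & tangent m = x.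
Proof.
move=> /andP[dx xc].
have [||m] := @IVT R tangent sY 1 x sY_le1.
- exact/continuous_subspaceT/tangent_continuous.
- by rewrite tangent_sY tangent1 ge_min le_max dx (ltW xc) orbT.
rewrite in_itv/= => /andP[ym m1] mx; exists m => //.
rewrite m1 andbT lt_neqAle ym andbT; apply/eqP => mE.
by move: xc; rewrite -mx -mE tangent_sY ltxx.
Qed.

Lemma fast_end_exists m : sU < m <= 1 -> exists x, fast_end x m.
Proof.
move=> /andP[um m1]; have [my|ym] := leP m sY; last first.
  by exists (tangent m); rewrite /fast_end leNgt ym/=.
have [|x /andP[cx _] xm] := @contact_onto_fast m; first by rewrite um.
by exists x; rewrite /fast_end my cx xm eqxx.
Qed.

Lemma fast_end_bounds x m : sU < m <= 1 -> fast_end x m -> sD2 <= x < sU.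
Proof.
move=> /andP[um m1]; rewrite /fast_end; have [my|ym] := leP m sY.
  move=> /andP[cx /eqP xm]; rewrite (le_trans sD2_le_sCY)//=.
  rewrite ltNge; apply/negP => Ux; move: um; rewrite -xm ltNge.
  by rewrite -[X in _ <= X]contact_sU contact_le// ltW// sCY_lt_sU.
move=> /eqP->; rewrite sD2_le_tangent ?(ltW um)//=.
by rewrite (lt_trans (tangent_lt_sCY _)) ?sCY_lt_sU// ym.
Qed.

Lemma fast_end_speed x m : sU < m <= 1 -> fast_end x m -> chord x m = upper_plus m.
Proof.
move=> /andP[um m1]; rewrite /fast_end; have [my|ym] := leP m sY.
  move=> /andP[_ /eqP xm].
  by rewrite upper_plus_low ?(ltW um)// -xm chordC -lam_cross_chord_contact.
by move=> /eqP->; rewrite upper_plus_high.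
Qed.

(** Monotonicity of [contact] on its decreasing branch and of [collin] turn the
    interval into the two inequalities.  The delicate case is a state on the
    increasing branch, left of [sCY]: there [contact u <= m] may hold again, but
    the tangency condition fails, since [collin sCY sCY sY] vanishes. *)
Lemma fast_end_joinable x m u : sU < m <= 1 -> fast_end x m ->
  (x <= u <= contact m) = (sD2 <= u) && joinable u m.
Proof.
move=> mU xm; have /andP[dx xU] := fast_end_bounds mU xm.
move/andP: mU => [um m1].
have x0 : 0 < x by exact: lt_le_trans sD2_gt0 dx.
have m0 : 0 < m by exact: lt_trans sU_gt0 um.
have m01 : 0 < m <= 1 by rewrite m0.
have x01 : 0 <= x <= 1 by rewrite !ltW// (lt_trans xU) ?sU_lt1.
apply/idP/idP.
- move=> /andP[xu uP]; rewrite (le_trans dx)//= /joinable uP andbT.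
  have uU : u < sU by exact: le_lt_trans uP (contact_lt_sU um).
  have u1 : u <= 1 by rewrite ltW// (lt_trans uU)// sU_lt1.
  have u0 : 0 < u by exact: lt_le_trans x0 xu.
  move: xm; rewrite /fast_end; have [my|ym] := leP m sY.
    move=> /andP[cx /eqP xm]; rewrite -{1}xm contact_le//=.
    rewrite (le_trans _ (collin_diag_le (ltW x0) xu u1 m01))// -xm.
    by rewrite collin_contact_ge0// ltW.
  move=> /eqP xm; rewrite (le_trans (contact_le_sY u0)) ?(ltW ym)//=.
  by rewrite (le_trans _ (collin_diag_le (ltW x0) xu u1 m01))// xm collin_tangent.
- move=> /andP[du /and3P[Pm tm ->]]; rewrite andbT leNgt; apply/negP => ux.
  have u0 : 0 < u by exact: lt_le_trans sD2_gt0 du.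
  have x1 : x <= 1 by case/andP: x01.
  have := collin_diag_lt (ltW u0) ux x1 m01; move: xm; rewrite /fast_end.
  have [my|ym] := leP m sY; last first.
    by move=> /eqP xm; rewrite {1 2}xm collin_tangent ltNge tm.
  move=> /andP[cx /eqP xm] _.
  have [uc|cu] := ltP u sCY; last first.
    by have := contact_lt cu ux; rewrite xm ltNge Pm.
  have := collin_diag_lt (ltW u0) uc (ltW sCY_lt1) m01.
  rewrite ltNge (le_trans _ tm)// -collin_sCY collin_far_le//.
  by rewrite !ltW ?sCY_gt0 ?sCY_lt1.
Qed.

Lemma fast_end_unique_high x m : 0 <= x <= 1 -> sU <= m <= 1 -> sY < m ->
  (collin x x m == 0) = fast_end x m.
Proof.
move=> x01 m01 ym; rewrite /fast_end leNgt ym/=.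
apply/eqP/eqP => [|->]; last exact: collin_tangent.
exact: tangent_unique.
Qed.

(** For [sY = 1] the first case of [fast_end] applies, and [sCY] and [sD2]
    coincide. *)
Lemma fast_end1 x : fast_end x 1 -> x = sD2.
Proof.
rewrite /fast_end; case: leP => [y1|_ /eqP->]; last exact: tangent1.
have yE : sY = 1 by apply/eqP; rewrite eq_le sY_le1.
move=> /andP[cx /eqP x1]; have x0 := lt_le_trans sCY_gt0 cx.
have [->|xc] := eqVneq x sCY; first by rewrite -tangent1 -yE tangent_sY.
by have := contact_lt_sCY x0 xc; rewrite x1 yE ltxx.
Qed.
End ScalarModel.

(** * Orbits of the reduced equation *)

Section TimeChange.
Context {R : realType}.
Implicit Types (s t u : R).

(** The mean value theorem makes T injective and, with the intermediate value
    theorem, onto; the inverse function theorem differentiates its inverse. *)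
Lemma inverse_of_growing (T T' : R -> R) (c : R) : 0 < c ->
  (forall u, is_derive u 1 T (T' u)) -> (forall u, c <= T' u) ->
  exists phi : R -> R, [/\ forall t, is_derive t 1 phi (T' (phi t))^-1,
    phi t @[t --> -oo] --> -oo & phi t @[t --> +oo] --> +oo].
Proof.
move=> c0 dT cT.
have contT : continuous T.
  by move=> u; apply: differentiable_continuous; apply/derivable1_diffP.
have growth u w : u <= w -> c * (w - u) <= T w - T u.
  move=> uw.
  have [|v _ ->] := @MVT_segment R T T' u w uw (fun v _ => dT v).
    exact: continuous_subspaceT.
  by rewrite ler_wpM2r ?subr_ge0.
have Tlt u w : u < w -> T u < T w.
  move=> uw; rewrite -subr_gt0; apply: lt_le_trans (growth _ _ (ltW uw)).
  by rewrite mulr_gt0// subr_gt0.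
have Tonto t : exists u, T u = t.
  pose n := `|t - T 0| / c.
  have n0 : 0 <= n by rewrite divr_ge0// ltW.
  have nc : c * n = `|t - T 0| by rewrite mulrC divfK// gt_eqF.
  have [|||u _ ut] := @IVT R T (- n) n t.
  - by rewrite ge0_cp.
  - exact: continuous_subspaceT.
  - have := growth (- n) 0; rewrite oppr_le0 sub0r opprK nc => /(_ n0) h1.
    have := growth 0 n n0; rewrite subr0 nc => h2.
    have h3 := ler_norm (t - T 0); have h4 := ler_normr (t - T 0).
    have h5 : - `|t - T 0| <= t - T 0 by rewrite lerNl ler_normr lexx orbT.
    by rewrite ge_min le_max; apply/andP; split; apply/orP; [left|right]; lra.
  by exists u.
pose phi t := sval (cid (Tonto t)).
have phiK t : T (phi t) = t by exact: svalP (cid (Tonto t)).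
have Tinj : injective T.
  by move=> u w uw; apply/eqP; rewrite eq_le !leNgt; apply/andP; split;
    apply/negP => /Tlt; rewrite uw ltxx.
have TK : cancel T phi by move=> u; apply: Tinj; rewrite phiK.
exists phi; split.
- move=> t; rewrite -[X in is_derive X](phiK t).
  apply: (@is_derive_inverse R T phi).
  + by near=> u; exact: TK.
  + by near=> u; exact: contT.
  + by rewrite gt_eqF// (lt_le_trans c0).
- apply/cvgrNyPle => A; near=> t; rewrite leNgt; apply/negP => /Tlt.
  rewrite phiK; apply/negP; rewrite -leNgt.
  by near: t; apply: nbhs_ninfty_le; exact: num_real.
- apply/cvgryPge => A; near=> t; rewrite leNgt; apply/negP => /Tlt.
  rewrite phiK; apply/negP; rewrite -leNgt.
  by near: t; apply: nbhs_pinfty_ge; exact: num_real.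
Unshelve. all: by end_near. Qed.

Definition logistic (x m u : R) : R := x + (m - x) * (expR u / (1 + expR u)).

Let e1 u : 1 + expR u != 0 :> R.
Proof. by rewrite gt_eqF// addr_gt0// expR_gt0. Qed.

Let e1C u : expR u + 1 != 0 :> R. Proof. by rewrite addrC. Qed.

Let expR0 u : expR u != 0 :> R. Proof. by rewrite gt_eqF ?expR_gt0. Qed.

Lemma logistic_itv x m u : x < m -> x < logistic x m u < m.
Proof.
move=> xm; rewrite /logistic ltrDl mulr_gt0 ?subr_gt0 ?divr_gt0 ?addr_gt0 ?expR_gt0//=.
rewrite -ltrBrDl -[ltRHS]mulr1 ltr_pM2l ?subr_gt0// ltr_pdivrMr ?mul1r ?ltrDr//.
Qed.

Lemma is_derive_logistic x m u : is_derive u 1 (logistic x m)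
  ((m - x) * expR u / (1 + expR u) ^+ 2).
Proof.
have de := is_derive_expR u.
have d1 : is_derive u 1 (fun u => 1 + expR u) (expR u).
  rewrite (_ : (fun _ => _) = cst 1 + expR)//.
  by apply: is_derive_eq; rewrite add0r.
have dV := @is_deriveV R (fun u => 1 + expR u) u _ _ (e1 u) d1.
have -> : logistic x m =
    cst x + (m - x) *: (expR * (fun u => (1 + expR u)^-1)).
  by apply/funext => v; rewrite !fctE.
apply: (is_derive_eq (is_deriveD (is_derive_cst x u 1)
  (is_deriveZ (m - x) (is_deriveM de dV)))).
by rewrite /GRing.scale/=; field; exact: e1.
Qed.

Lemma logistic_cvgy x m : logistic x m u @[u --> +oo] --> m.
Proof.
rewrite [X in _ --> X](_ : m = x + (m - x) * (1 + 0)^-1); last first.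
  by rewrite addr0 invr1 mulr1 addrC subrK.
have -> : logistic x m = fun u => x + (m - x) * (1 + expR (- u))^-1.
  apply/funext => u; rewrite /logistic; congr (_ + _ * _).
  by rewrite expRN; field; rewrite expR0 e1C.
apply: cvgD; first exact: cvg_cst.
apply: cvgM; first exact: cvg_cst.
apply: cvgV; first by rewrite addr0 oner_eq0.
by apply: cvgD; [exact: cvg_cst|exact: cvgr_expR].
Qed.

Lemma logistic_cvgNy x m : logistic x m u @[u --> -oo] --> x.
Proof.
apply/cvgNy_compNP.
rewrite (_ : _ \o _ = logistic m x); first exact: logistic_cvgy.
apply/funext => u; rewrite /logistic/= expRN.
by field; rewrite ?expR0 ?e1 ?e1C.
Qed.

Lemma is_derive_ln_affine (a b : R) u : 0 < a -> 0 < b ->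
  is_derive u 1 (@ln R \o (fun u => a + b * expR u)) (b * expR u / (a + b * expR u)).
Proof.
move=> a0 b0.
have e0 : 0 < a + b * expR u by rewrite addr_gt0// mulr_gt0 ?expR_gt0.
have de := is_derive_expR u.
have d1 : is_derive u 1 (fun u => a + b * expR u) (b * expR u).
  have -> : (fun u => a + b * expR u) = cst a + b *: @expR R.
    by apply/funext => v; rewrite !fctE.
  by apply: (is_derive_eq (is_deriveD (is_derive_cst a u 1) (is_deriveZ b de)));
    rewrite add0r.
apply: (is_derive_eq (@is_derive1_comp R (@ln R) (fun u => a + b * expR u) u
  _ _ (is_derive1_ln e0) d1)).
by rewrite mulrC.
Qed.

Lemma antiderivative_logistic x m :
  exists J : R -> R, forall u, is_derive u 1 J (logistic x m u).
Proof.
exists (x *: id + (m - x) *: (@ln R \o (fun u => 1 + 1 * expR u))) => u.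
apply: (is_derive_eq (is_deriveD (is_deriveZ x (is_derive_id u 1))
  (is_deriveZ (m - x) (is_derive_ln_affine u ltr01 ltr01)))).
by rewrite /GRing.scale/= /logistic !mul1r mulr1.
Qed.

(** The case [p = 0] is that of a chord tangent at its left end: the integrand
    then grows exponentially as u tends to [-oo], which reflects the algebraic
    rate at which the orbit leaves a degenerate equilibrium. *)
Lemma antiderivative_inv_affine (p q : R) : 0 <= p -> 0 < q ->
  exists J : R -> R, forall u, is_derive u 1 J
    (p + q * (expR u / (1 + expR u)))^-1.
Proof.
rewrite le_eqVlt => /predU1P[<-|p0] q0.
- exists (q^-1 *: (id - (expR \o -%R))) => u.
  have dN : is_derive u 1 (-%R : R -> R) (- 1) := is_deriveN (is_derive_id u 1).
  have de := @is_derive1_comp R (@expR R) -%R u _ _ (is_derive_expR (- u)) dN.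
  apply: (is_derive_eq (is_deriveZ q^-1 (is_deriveB (is_derive_id u 1) de))).
  rewrite /GRing.scale/= add0r expRN.
  by field; rewrite ?expR0 ?e1 ?e1C gt_eqF.
- have pq0 : 0 < p + q by rewrite addr_gt0.
  exists (p^-1 *: (id - (q / (p + q)) *:
    (@ln R \o (fun u => p + (p + q) * expR u)))) => u.
  apply: (is_derive_eq (is_deriveZ p^-1 (is_deriveB (is_derive_id u 1)
    (is_deriveZ (q / (p + q)) (is_derive_ln_affine u p0 pq0))))).
  have e0 : p + (p + q) * expR u != 0.
    by rewrite gt_eqF// addr_gt0// mulr_gt0 ?expR_gt0.
  have e2 : p * (1 + expR u) + q * expR u != 0.
    by rewrite (_ : _ + _ = p + (p + q) * expR u)//; ring.
  have pq : p + q != 0 by rewrite gt_eqF.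
  have p0' : p != 0 by rewrite gt_eqF.
  by rewrite /GRing.scale/=; field; rewrite e1 e2 pq p0'.
Qed.

(** Writing the unknown as [logistic x m u] absorbs the factors that vanish at
    both equilibria; what remains is [u' = 1 / T' u] with T' bounded below by a
    positive constant, solved by inverting an antiderivative of T'. *)
Lemma heteroclinic (nu x m : R) : 1 < nu -> 0 <= x -> x < m <= 1 ->
  0 <= collin nu x x m ->
  exists s : R -> R, [/\ forall t, x < s t < m,
    forall t, is_derive t 1 s ((s t - x) * (chord nu x (s t) - chord nu x m)),
    s t @[t --> -oo] --> x & s t @[t --> +oo] --> m].
Proof.
move=> nu1 x0 /andP[xm m1] p0; set p := collin nu x x m in p0.
have nu0 : 0 < nu by lra.
have mx0 : 0 < m - x by rewrite subr_gt0.
pose a := (1 + nu) * (x * (1 - m) + m * (1 - x)).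
have a0 : 0 < a.
  rewrite mulr_gt0 ?ltr_wpDl ?mulr_ge0 ?subr_ge0// ?mulr_gt0 ?subr_gt0//; lra.
pose S := logistic x m.
have Sx u : S u - x = (m - x) * (expR u / (1 + expR u)).
  by rewrite /S /logistic addrC addKr.
have collinS u : collin nu x (S u) m = p + a * (m - x) * (expR u / (1 + expR u)).
  by rewrite -mulrA -Sx /p /a /collin; ring.
have S_itv u : x < S u < m by exact: logistic_itv.
have collin_gt0 u : 0 < collin nu x (S u) m.
  rewrite collinS ltr_wpDl//; apply: mulr_gt0; first exact: mulr_gt0.
  by rewrite divr_gt0 ?addr_gt0 ?expR_gt0.
pose K := mobl nu x * mobl nu m / ((m - x) * nu).
have K0 : 0 < K by rewrite divr_gt0 ?mulr_gt0 ?mobl_gt0.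
pose T' u := K * (mobl nu (S u) / collin nu x (S u) m).
have [J1 dJ1] := antiderivative_logistic x m.
have [J2 dJ2] := antiderivative_inv_affine p0 (mulr_gt0 a0 mx0).
(* [collin x s m] is the affine function a * (s - r), so dividing mobl by it
   leaves an affine part and a multiple of its inverse. *)
pose r := x - p / a.
pose b := ((1 + nu) * r - 2 * nu) / a.
pose T := K *: ((((1 + nu) / a) *: J1 + b *: id) + mobl nu r *: J2).
have dT u : is_derive u 1 T (T' u).
  apply: (is_derive_eq (is_deriveZ K (is_deriveD (is_deriveD (is_deriveZ _ (dJ1 u))
    (is_deriveZ b (is_derive_id u 1))) (is_deriveZ _ (dJ2 u))))).
  rewrite -collinS -/(S u) /T' /GRing.scale/=; congr (_ * _).
  have t0 : collin nu x (S u) m != 0 by rewrite gt_eqF.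
  have a00 : a != 0 by rewrite gt_eqF.
  have tE : collin nu x (S u) m = a * (S u - r).
    by rewrite collinS -mulrA -Sx /r; field.
  have Sr : S u - r != 0 by move: t0; rewrite tE mulf_eq0 negb_or => /andP[].
  by rewrite tE /b /mobl; field; rewrite a00 Sr.
have T'_ge u : K * (nu / (1 + nu) / (3 * (1 + nu))) <= T' u.
  have /andP[xS Sm] := S_itv u.
  have E_ge : nu / (1 + nu) <= mobl nu (S u).
    rewrite ler_pdivrMr; last by lra.
    have -> : mobl nu (S u) * (1 + nu) = ((1 + nu) * S u - nu) ^+ 2 + nu.
      by rewrite /mobl; ring.
    by rewrite lerDr sqr_ge0.
  have t_le : collin nu x (S u) m <= 3 * (1 + nu).
    have h1 : x * S u <= 1 by rewrite mulr_ile1//; lra.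
    have h2 : S u * m <= 1 by rewrite mulr_ile1//; lra.
    have h3 : m * x <= 1 by rewrite mulr_ile1//; lra.
    have h4 : 0 <= x * S u * m by rewrite !mulr_ge0//; lra.
    rewrite -subr_ge0 (_ : _ - _ = (1 + nu) * ((1 - x * S u) + (1 - S u * m)
      + (1 - m * x) + 2 * (x * S u * m)) + nu); last by rewrite /collin; ring.
    by rewrite addr_ge0 ?mulr_ge0//; lra.
  have k3 : 0 < 3 * (1 + nu) by lra.
  rewrite ler_pM2l//; apply: ler_pM => //.
  - by rewrite divr_ge0//; lra.
  - by rewrite invr_ge0 ltW.
  - by rewrite lef_pV2 ?posrE.
have c0 : 0 < K * (nu / (1 + nu) / (3 * (1 + nu))).
  by rewrite mulr_gt0// !divr_gt0//; lra.
have [phi [dphi phiNy phiy]] := inverse_of_growing c0 dT T'_ge.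
exists (S \o phi); split.
- by move=> t; exact: S_itv.
- move=> t; apply: (is_derive_eq (@is_derive1_comp R S phi t _ _
    (is_derive_logistic x m (phi t)) (dphi t))).
  rewrite chord_sub// -/(S _) /T' /K.
  have dS : (m - x) * expR (phi t) / (1 + expR (phi t)) ^+ 2
      = (S (phi t) - x) * (m - S (phi t)) / (m - x).
    by rewrite /S /logistic; field; rewrite e1 subr_eq0 gt_eqF.
  have t0 : collin nu x (S (phi t)) m != 0 by rewrite gt_eqF.
  have E1 := mobl_neq0 nu1 x; have E2 := mobl_neq0 nu1 m.
  have E3 := mobl_neq0 nu1 (S (phi t)).
  rewrite dS; set A := collin _ _ _ _ in t0 *; set B := mobl _ x in E1 *.
  set C := mobl _ m in E2 *; set D := mobl _ _ in E3 *; clearbody A B C D.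
  by rewrite /=; field; rewrite t0 E1 E2 E3 subr_eq0 !gt_eqF.
- apply: (@cvg_comp _ _ _ phi S _ _ _ phiNy); exact: logistic_cvgNy.
- apply: (@cvg_comp _ _ _ phi S _ _ _ phiy); exact: logistic_cvgy.
Qed.
End TimeChange.

(** * The frontier of a band between two graphs *)

Section PlaneBands.
Context {R : realType}.
Implicit Types (a b e s t : R) (p : R * R) (A : set R).

Lemma nbhs_two_sided s A : nbhs s A ->
  exists2 e, 0 < e & forall d, 0 < d < e -> A (s - d) /\ A (s + d).
Proof.
move=> /nbhs_ballP[e /= e0 sA]; exists e => // d /andP[d0 de].
split; apply: sA; rewrite /ball/=.
- by rewrite opprB addrCA subrr addr0 gtr0_norm.
- by rewrite opprD addNKr normrN gtr0_norm.
Qed.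

Lemma nbhs_meets_oo a b s A : a < b -> a <= s <= b -> nbhs s A ->
  exists2 t, a < t < b & A t.
Proof.
move=> ab /andP[as_ sb] /nbhs_two_sided[e e0 eA].
pose d := Num.min (e / 2) ((b - a) / 3).
have d0 : 0 < d by rewrite lt_min !divr_gt0 ?subr_gt0.
have de : d <= e / 2 by rewrite ge_min lexx.
have db : d <= (b - a) / 3 by rewrite ge_min lexx orbT.
have /eA[Al Ar] : 0 < d < e by rewrite d0/=; lra.
have [sm|sm] := leP s ((a + b) / 2).
- by exists (s + d) => //; apply/andP; split; lra.
- by exists (s - d) => //; apply/andP; split; lra.
Qed.

Lemma pair_continuous {T U V : topologicalType} (f : T -> U) (g : T -> V) :
  continuous f -> continuous g -> continuous (fun x => (f x, g x)).
Proof. by move=> cf cg x; apply: cvg_pair; [exact: cf|exact: cg]. Qed.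

Variables (lo hi : R -> R) (a b : R).
Hypotheses (clo : continuous lo) (chi : continuous hi) (ab : a < b).
Hypothesis lohi : forall s, a <= s <= b -> lo s <= hi s.

Definition band : set (R * R) :=
  [set p | a <= p.1 <= b /\ lo p.1 <= p.2 <= hi p.1].
Definition open_band : set (R * R) :=
  [set p | a < p.1 < b /\ lo p.1 < p.2 < hi p.1].

Let cfst : continuous (fst : R * R -> R).
Proof. by move=> p; exact: cvg_fst. Qed.

Let csnd : continuous (snd : R * R -> R).
Proof. by move=> p; exact: cvg_snd. Qed.

Let cgap (f : R -> R) : continuous f -> continuous (fun p : R * R => p.2 - f p.1).
Proof.
move=> cf p; apply: cvgB; first exact: csnd.
exact: (continuous_comp (@cfst p) (cf p.1)).
Qed.

Lemma closed_band : closed band.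
Proof.
have -> : band = ((fun p : R * R => p.1) @^-1` [set x | a <= x] `&`
                  (fun p : R * R => p.1) @^-1` [set x | x <= b]) `&`
                 ((fun p : R * R => p.2 - lo p.1) @^-1` [set x | 0 <= x] `&`
                  (fun p : R * R => p.2 - hi p.1) @^-1` [set x | x <= 0]).
  rewrite eqEsubset; split=> p /=; rewrite /band/= subr_ge0 subr_le0.
    by move=> [/andP[-> ->] /andP[-> ->]].
  by move=> [[-> ->] [-> ->]].
by apply: closedI; apply: closedI; apply: preimage_closed;
  (exact: closed_le || exact: closed_ge || (move=> p _; by [exact: cfst|exact: cgap])).
Qed.

Lemma open_open_band : open open_band.
Proof.
have -> : open_band = ((fun p : R * R => p.1) @^-1` [set x | a < x] `&`
                  (fun p : R * R => p.1) @^-1` [set x | x < b]) `&`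
                 ((fun p : R * R => p.2 - lo p.1) @^-1` [set x | 0 < x] `&`
                  (fun p : R * R => p.2 - hi p.1) @^-1` [set x | x < 0]).
  rewrite eqEsubset; split=> p /=; rewrite /open_band/= subr_gt0 subr_lt0.
    by move=> [/andP[-> ->] /andP[-> ->]].
  by move=> [[-> ->] [-> ->]].
by apply: openI; apply: openI; apply: open_comp;
  (exact: open_lt || exact: open_gt || (move=> p _; by [exact: cfst|exact: cgap])).
Qed.

(** B is the band with an arbitrary part of its two vertical sides: the
    surfaces are half-open there. *)
Variable B : set (R * R).
Hypothesis Bsub : B `<=` band.
Hypothesis Bsup : forall s v, a < s < b -> lo s <= v <= hi s -> B (s, v).

(** A point of the closed band keeps its relative height between the two graphs
    while its abscissa is moved inside. *)
Lemma closure_band : closure B = band.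
Proof.
rewrite eqEsubset; split.
  by rewrite [X in _ `<=` X](closure_id _).1; [exact: closure_subset|exact: closed_band].
move=> [s v] [/= sab /andP[lv vh]].
have [th [th0 th1 vE]] : exists th, [/\ 0 <= th, th <= 1 & v = lo s + th * (hi s - lo s)].
  have [lh|lh] := eqVneq (lo s) (hi s).
    exists 0; rewrite lexx ler01 mul0r addr0; split=> //.
    by apply/eqP; rewrite eq_le lv lh vh.
  have lh0 : 0 < hi s - lo s by rewrite subr_gt0 lt_neqAle lh (le_trans lv).
  exists ((v - lo s) / (hi s - lo s)); split.
  - by rewrite divr_ge0 ?subr_ge0// (le_trans lv).
  - by rewrite ler_pdivrMr// mul1r lerB.
  - by rewrite divfK ?gt_eqF// addrC subrK.
pose g t : R * R := (t, lo t + th * (hi t - lo t)).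
have cg : continuous g.
  apply: pair_continuous => [t|t]; first exact: cvg_id.
  apply: cvgD; first exact: clo.
  by apply: cvgM; [exact: cvg_cst|apply: cvgB; [exact: chi|exact: clo]].
have -> : (s, v) = g s by rewrite /g -vE.
move=> N /(cg s) Ns.
have [t tab Nt] := nbhs_meets_oo ab sab Ns.
exists (g t); split=> //; apply: Bsup => //.
have lht : lo t <= hi t by apply: lohi; case/andP: tab => ta tb; rewrite !ltW.
rewrite lerDl mulr_ge0 ?subr_ge0//= -lerBrDl.
by rewrite ler_piMl ?subr_ge0.
Qed.

(** Horizontal and vertical moves in both directions leave the band from any
    point that lies on its frontier. *)
Lemma interior_band : interior B = open_band.
Proof.
rewrite eqEsubset; split; last first.
  rewrite -open_subsetE; last exact: open_open_band.
  move=> [s v] [/= sab /andP[lv vh]]; apply: Bsup => //.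
  by rewrite !ltW.
move=> [s v] sB.
have hor : nbhs s [set t | B (t, v)].
  have ch : continuous (fun t : R => (t, v)).
    by apply: pair_continuous => [t|t]; [exact: cvg_id|exact: cvg_cst].
  exact: (ch s B sB).
have ver : nbhs v [set w | B (s, w)].
  have cv : continuous (fun w : R => (s, w)).
    by apply: pair_continuous => [t|t]; [exact: cvg_cst|exact: cvg_id].
  exact: (cv v B sB).
have [e e0 eh] := nbhs_two_sided hor.
have [f f0 fv] := nbhs_two_sided ver.
have e2 : 0 < e / 2 < e by apply/andP; split; lra.
have f2 : 0 < f / 2 < f by apply/andP; split; lra.
have [/Bsub[/= /andP[h1 _] _] /Bsub[/= /andP[_ h2] _]] := eh _ e2.
have [/Bsub[/= _ /andP[h3 _]] /Bsub[/= _ /andP[_ h4]]] := fv _ f2.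
by split=> /=; apply/andP; split; lra.
Qed.

Lemma band_boundary : closure B `\` interior B =
  [set (s, lo s) | s in `[a, b]] `|` [set (s, hi s) | s in `[a, b]] `|`
  [set (a, v) | v in `[lo a, hi a]] `|` [set (b, v) | v in `[lo b, hi b]].
Proof.
rewrite closure_band interior_band eqEsubset; split.
- move=> [s v] [[/= sab lvh] nop].
  have [sa|sa] := eqVneq s a.
    by left; right; exists v; rewrite /= ?in_itv/= -?sa.
  have [sb|sb] := eqVneq s b.
    by right; exists v; rewrite /= ?in_itv/= -?sb.
  have [vl|vl] := eqVneq v (lo s).
    by left; left; left; exists s; rewrite /= ?in_itv/= ?vl.
  have [vh|vh] := eqVneq v (hi s).
    by left; left; right; exists s; rewrite /= ?in_itv/= ?vh.
  case: nop; split=> /=; rewrite !lt_neqAle.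
    by rewrite sb [_ == s]eq_sym sa.
  by rewrite vh [_ == v]eq_sym vl.
- have aa : a <= a <= b by rewrite lexx ltW.
  have bb : a <= b <= b by rewrite lexx ltW.
  move=> p [[[|]|]|] [s /=]; rewrite in_itv/= => sab <-; split.
  + by split=> //=; rewrite lexx lohi.
  + by move=> [/= _]; rewrite ltxx.
  + by split=> //=; rewrite lexx lohi.
  + by move=> [/= _]; rewrite ltxx andbF.
  + by split.
  + by move=> [/=]; rewrite ltxx.
  + by split.
  + by move=> [/=]; rewrite ltxx andbF.
Qed.

End PlaneBands.

Section Arcs.
Context {R : realType}.
Implicit Types (A : set (state R * R)) (p q : state R * R).

Lemma arc_of_segment (c : R -> state R * R) (a b : R) : a <= b ->
  continuous c -> set_inj `[a, b] c ->
  arc_from_to (c @` `[a, b]) (c a) (c b) /\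
  arc_from_to (c @` `[a, b]) (c b) (c a).
Proof.
rewrite le_eqVlt => /predU1P[<- _ _|ab cc ci].
  by split; right; split=> //; rewrite set_itv1 image_set1.
have arc (f h : R -> R) : continuous f -> f @` `[0, 1] = `[a, b]%classic ->
    (forall t, h (f t) = t) ->
    arc_from_to (c @` `[a, b]) (c (f 0)) (c (f 1)).
  move=> cf fI fK; left; exists (c \o f); split=> //.
  - apply: continuous_subspaceT => t.
    exact: continuous_comp (cf t) (cc (f t)).
  - move=> s t s01 t01 /= cst; rewrite -[s]fK -[t]fK; congr (h _).
    apply: ci cst; rewrite inE -fI; [exists s|exists t] => //.
      by move: s01; rewrite inE.
    by move: t01; rewrite inE.
  - by rewrite -fI image_comp.
have ba : b - a != 0 by rewrite subr_eq0 gt_eqF.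
split.
- have := @arc (fun t => a + t * (b - a)) (fun s => (s - a) / (b - a)).
  rewrite mul0r addr0 mul1r [a + (b - a)]addrC subrK; apply.
  + move=> t; apply: cvgD; first exact: cvg_cst.
    by apply: cvgM; [exact: cvg_id|exact: cvg_cst].
  + rewrite eqEsubset; split=> s /=; rewrite ?in_itv/=.
      move=> [t]; rewrite in_itv/= => /andP[t0 t1] <-.
      by apply/andP; split; nra.
    move=> /andP[as_ sb]; exists ((s - a) / (b - a)).
      rewrite in_itv/= divr_ge0 ?subr_ge0 ?(ltW ab)//= ler_pdivrMr ?subr_gt0//.
      by rewrite mul1r lerB.
    by rewrite divfK// addrC subrK.
  + by move=> t; rewrite addrAC subrr add0r mulfK.
- have := @arc (fun t => b - t * (b - a)) (fun s => (b - s) / (b - a)).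
  rewrite mul0r subr0 mul1r subKr; apply.
  + move=> t; apply: cvgB; first exact: cvg_cst.
    by apply: cvgM; [exact: cvg_id|exact: cvg_cst].
  + rewrite eqEsubset; split=> s /=; rewrite ?in_itv/=.
      move=> [t]; rewrite in_itv/= => /andP[t0 t1] <-.
      by apply/andP; split; nra.
    move=> /andP[as_ sb]; exists ((b - s) / (b - a)).
      rewrite in_itv/= divr_ge0 ?subr_ge0 ?(ltW ab)//= ler_pdivrMr ?subr_gt0//.
      by rewrite mul1r lerB.
    by rewrite divfK// subKr.
  + by move=> t; rewrite subKr mulfK.
Qed.
End Arcs.

(** * The invariant line *)

Section InvariantLine.
Context {R : realType} (mu : viscosity R).
Hypotheses (hw : 0 < mu_w mu) (ho : 0 < mu_o mu) (hg : 0 < mu_g mu).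
Hypothesis nu1 : 1 < nuG mu.
Implicit Types (U V : state R) (s t x m : R).

Local Notation nu := (nuG mu).
Local Notation L := (line_state mu).

Let hwo : 0 < mu_w mu + mu_o mu. Proof. exact: addr_gt0. Qed.

Let w0 : mu_w mu != 0. Proof. by rewrite gt_eqF. Qed.

Let o0 : mu_o mu != 0. Proof. by rewrite gt_eqF. Qed.

Let g0 : mu_g mu != 0. Proof. by rewrite gt_eqF. Qed.

Let wo0 : mu_w mu + mu_o mu != 0. Proof. by rewrite gt_eqF. Qed.

Lemma mk_stateE U : U = mk_state (sw U) (so U).
Proof.
apply/rowP => i; rewrite mxE; case: eqP => [->//|].
case: i => -[|[|//]] i2 ne; first by case: ne; exact: val_inj.
by rewrite /so; congr (U _ _); exact: val_inj.
Qed.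

Lemma sw_mk (a b : R) : sw (mk_state a b) = a. Proof. by rewrite /sw mxE. Qed.

Lemma so_mk (a b : R) : so (mk_state a b) = b. Proof. by rewrite /so mxE. Qed.

Lemma state_eq U V : sw U = sw V -> so U = so V -> U = V.
Proof. by move=> e1 e2; rewrite [U]mk_stateE [V]mk_stateE e1 e2. Qed.

Lemma swD U V : sw (U + V) = sw U + sw V. Proof. by rewrite /sw mxE. Qed.

Lemma soD U V : so (U + V) = so U + so V. Proof. by rewrite /so mxE. Qed.

Lemma swN U : sw (- U) = - sw U. Proof. by rewrite /sw mxE. Qed.

Lemma soN U : so (- U) = - so U. Proof. by rewrite /so mxE. Qed.

Lemma swZ (a : R) U : sw (a *: U) = a * sw U. Proof. by rewrite /sw mxE. Qed.

Lemma soZ (a : R) U : so (a *: U) = a * so U. Proof. by rewrite /so mxE. Qed.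

Definition stateE := (sw_mk, so_mk, swD, soD, swN, soN, swZ, soZ).

Definition dirD : state R := L 1.

Lemma line_stateE s : L s = s *: dirD.
Proof. by apply: state_eq; rewrite /dirD /line_state !stateE !mul1r mulrA. Qed.

Lemma param_line s : param (L s) = s.
Proof.
rewrite /param /line_state !stateE -mulrDl -mulrDr mulfK//.
Qed.

Lemma line_state_inj : injective L.
Proof. by move=> s t st; rewrite -[s]param_line st param_line. Qed.

Lemma line_state_sub s t : L s - L t = (s - t) *: dirD.
Proof. by rewrite !line_stateE scalerBl. Qed.

Lemma dirD_neq0 : dirD != 0.
Proof.
apply/eqP => e; have := @line_state_inj 1 0; rewrite [L 0]line_stateE scale0r.
by move=> /(_ e)/eqP; rewrite oner_eq0.
Qed.

Lemma Omega_line s : Omega (L s) <-> 0 <= s <= 1.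
Proof.
rewrite /Omega/= -/(param _) param_line /line_state !stateE.
rewrite !pmulr_lge0 ?invr_gt0//; split=> [[-> _ ->]//|/andP[-> ->]//].
Qed.

Lemma segmentP U : segment_GD mu U <-> exists2 s, 0 <= s <= 1 & U = L s.
Proof.
split=> [[UO Ue]|[s s01 ->]]; last first.
  split; first exact/Omega_line.
  rewrite /line_state !stateE; field; by rewrite w0 o0 wo0.
have UL : U = L (param U).
  have Ue' : sw U * mu_o mu = so U * mu_w mu.
    by move/eqP: Ue; rewrite eqr_div// => /eqP.
  apply: state_eq; rewrite /line_state !stateE /param; apply/esym/eqP.
    by rewrite mulrDl -Ue' -mulrDr mulfK.
  by rewrite mulrDl Ue' addrC -mulrDr [mu_o mu + _]addrC mulfK.
by exists (param U) => //; rewrite -Omega_line -UL.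
Qed.

Lemma umbilicE : umbilic mu = L (sU nu).
Proof.
have n0 : mu_w mu + mu_o mu + mu_g mu != 0 by rewrite gt_eqF// addr_gt0.
have n1 : mu_g mu + mu_w mu + mu_o mu != 0 by rewrite -addrA addrC.
have n2 : mu_g mu + (mu_w mu + mu_o mu) != 0 by rewrite addrA.
apply: state_eq; rewrite /umbilic /line_state !stateE /sU /nuG; field;
  by rewrite ?n0 ?n1 ?n2 ?g0 ?wo0.
Qed.

Lemma seg_GUP U : seg_GU mu U <-> exists2 s, 0 <= s < sU nu & U = L s.
Proof.
rewrite /seg_GU/= umbilicE param_line segmentP; split.
  by move=> [[s /andP[s0 s1] ->]]; rewrite param_line => sU; exists s; rewrite ?s0.
move=> [s /andP[s0 sU] ->]; rewrite param_line; split=> //; exists s => //.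
by rewrite s0 ltW// (lt_trans sU)// sU_lt1.
Qed.

Lemma seg_UDP U : seg_UD mu U <-> exists2 s, sU nu < s <= 1 & U = L s.
Proof.
rewrite /seg_UD/= umbilicE param_line segmentP; split.
  by move=> [[s /andP[s0 s1] ->]]; rewrite param_line => sU; exists s; rewrite ?sU.
move=> [s /andP[sU s1] ->]; rewrite param_line; split=> //; exists s => //.
by rewrite s1 ltW// (lt_trans _ sU)// sU_gt0.
Qed.

Lemma mobility_gt0 U : 0 < mobility mu U.
Proof.
rewrite lt_def !addr_ge0 ?divr_ge0 ?sqr_ge0 ?(ltW hw) ?(ltW ho) ?(ltW hg)// andbT.
rewrite !paddr_eq0 ?addr_ge0 ?divr_ge0 ?sqr_ge0 ?(ltW hw) ?(ltW ho) ?(ltW hg)//.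
rewrite !mulf_eq0 !invr_eq0 (negbTE w0) (negbTE o0) (negbTE g0) !orbF !orbb.
apply/negP => /andP[/andP[/eqP e1 /eqP e2]].
by rewrite /sg e1 e2 !subr0 oner_eq0.
Qed.

Lemma mobility_line s : mobility mu (L s) = mobl nu s / (mu_w mu + mu_o mu).
Proof.
rewrite /mobility /sg /line_state !stateE /mobl /nuG; field.
by rewrite w0 o0 g0 wo0.
Qed.

Lemma flux_line s : flux mu (L s) = (s ^+ 2 / mobl nu s) *: dirD.
Proof.
have e0 := mobl_neq0 nu1 s.
apply: state_eq; rewrite /flux mobility_line /dirD /line_state !stateE;
  move: e0; set E := mobl nu s; clearbody E => e0; field;
  by rewrite ?w0 ?o0 ?e0 ?wo0.
Qed.

Lemma flux_line_sub x m :
  flux mu (L m) - flux mu (L x) = chord nu x m *: (L m - L x).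
Proof.
rewrite !flux_line -scalerBl line_state_sub scalerA; congr (_ *: _).
rewrite /chord; have := mobl_neq0 nu1 x; have := mobl_neq0 nu1 m.
by rewrite /mobl => h1 h2; field; rewrite h1 h2.
Qed.

Lemma rh_speed_line x m : x != m -> rh_speed mu (L x) (L m) = chord nu x m.
Proof.
move=> xm; apply: get_unique; first exact: flux_line_sub.
move=> v /=; rewrite flux_line_sub => /eqP; rewrite -subr_eq0 -scalerBl scaler_eq0.
move=> /orP[|]; first by rewrite subr_eq0 => /eqP.
rewrite line_state_sub scaler_eq0 (negbTE dirD_neq0) orbF subr_eq0 eq_sym.
by rewrite (negbTE xm).
Qed.

Lemma line_continuous : continuous L.
Proof.
rewrite (_ : line_state mu = fun s => s *: dirD); last first.
  by apply/funext => s; rewrite line_stateE.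
exact: scalel_continuous.
Qed.

(** * Eigenvalues on the line *)

Lemma is_derive_coord i j (p v : state R) :
  is_derive p v (fun U : state R => U i j) (v i j).
Proof.
have d : differentiable (fun U : state R => U i j : R) p.
  exact: differentiable_coord.
apply: DeriveDef; first exact: diff_derivable.
have := derive_mx (@derivable_id _ _ p v); rewrite derive_id => /matrixP/(_ i j).
by rewrite mxE => <-.
Qed.

Definition dmobility U V : R :=
  2 * (sw U * sw V / mu_w mu + so U * so V / mu_o mu
       - sg U * (sw V + so V) / mu_g mu).

Lemma is_derive_mobility (p v : state R) :
  is_derive p v (mobility mu) (dmobility p v).
Proof.
have dw : is_derive p v (@sw R) (sw v) by exact: is_derive_coord.
have do_ : is_derive p v (@so R) (so v) by exact: is_derive_coord.
have dg : is_derive p v (@sg R) (- (sw v + so v)).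
  rewrite (_ : @sg R = cst 1 - @sw R - @so R)//.
  by apply: is_derive_eq; rewrite sub0r opprD.
rewrite (_ : mobility mu = (mu_w mu)^-1 *: (@sw R ^+ 2) + (mu_o mu)^-1 *: (@so R ^+ 2)
   + (mu_g mu)^-1 *: (@sg R ^+ 2)); last first.
  apply/funext => U; rewrite /mobility !fctE /GRing.scale/=.
  by rewrite ![_ ^+ 2 / _]mulrC.
have sq (f : state R -> R) df : is_derive p v f df ->
    is_derive p v (f ^+ 2) (2 * f p * df).
  by move=> fd; apply: is_derive_eq; rewrite /GRing.scale/= expr1 -mulr_natl; ring.
apply: (is_derive_eq (is_deriveD (is_deriveD (is_deriveZ _ (sq _ _ dw))
  (is_deriveZ _ (sq _ _ do_))) (is_deriveZ _ (sq _ _ dg)))).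
by rewrite /dmobility /GRing.scale/=; field; rewrite w0 o0 g0.
Qed.

Lemma is_derive_frac (f : state R -> R) (p v : state R) df : is_derive p v f df ->
  is_derive p v (fun U => f U / mobility mu U)
    ((df * mobility mu p - f p * dmobility p v) / mobility mu p ^+ 2).
Proof.
move=> fd; have md := is_derive_mobility p v.
have m0 : mobility mu p != 0 by rewrite gt_eqF// mobility_gt0.
have mv : is_derive p v (fun U => (mobility mu U)^-1)
    (- mobility mu p ^- 2 * dmobility p v).
  by apply: DeriveDef; [exact: derivableV|rewrite deriveV// derive_val].
rewrite (_ : (fun U => _) = f * (fun U => (mobility mu U)^-1))//.
apply: is_derive_eq; rewrite /GRing.scale/=; field; exact: m0.
Qed.

Lemma flux_differentiable p : differentiable (flux mu) p.
Proof.
have dc i j : differentiable (fun U : state R => U i j : R) p.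
  exact: differentiable_coord.
have dm : differentiable (mobility mu) p.
  rewrite (_ : mobility mu = (mu_w mu)^-1 *: (@sw R ^+ 2) + (mu_o mu)^-1 *: (@so R ^+ 2)
     + (mu_g mu)^-1 *: (@sg R ^+ 2)); last first.
    apply/funext => U; rewrite /mobility !fctE /GRing.scale/=.
    by rewrite ![_ ^+ 2 / _]mulrC.
  have dg : differentiable (@sg R) p.
    rewrite (_ : @sg R = cst 1 - @sw R - @so R)//.
    by apply: differentiableB; [apply: differentiableB|];
      [exact: differentiable_cst|exact: dc|exact: dc].
  by apply: differentiableD; [apply: differentiableD|]; apply: differentiableZ;
    apply: differentiableX; [exact: dc|exact: dc|exact: dg].
have dmV : differentiable (fun U => (mobility mu U)^-1) p.
  by apply: differentiableV; rewrite // gt_eqF// mobility_gt0.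
pose quot (a : R) (c : state R -> R) :=
  a^-1 *: (c ^+ 2) * (fun U => (mobility mu U)^-1).
rewrite (_ : flux mu =
    (fun U => quot (mu_w mu) (@sw R) U *: (mk_state 1 0 : state R)) +
    (fun U => quot (mu_o mu) (@so R) U *: (mk_state 0 1 : state R))); last first.
  apply/funext => U; rewrite /quot !fctE /GRing.scale/= /flux.
  apply: state_eq; rewrite !stateE !(mulr0, mulr1, addr0, add0r).
    by rewrite [_ ^+ 2 / _]mulrC.
  by rewrite [_ ^+ 2 / _]mulrC.
by apply: differentiableD; apply: differentiableZl; apply: differentiableM => //;
  apply: differentiableZ; apply: differentiableX; exact: dc.
Qed.

Lemma derive_flux (p v : state R) : 'D_v (flux mu) p =
  mk_state
    ((2 * sw p * sw v / mu_w mu * mobility mu p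
      - sw p ^+ 2 / mu_w mu * dmobility p v) / mobility mu p ^+ 2)
    ((2 * so p * so v / mu_o mu * mobility mu p
      - so p ^+ 2 / mu_o mu * dmobility p v) / mobility mu p ^+ 2).
Proof.
rewrite derive_mx; last exact/diff_derivable/flux_differentiable.
have sq i j a : is_derive p v (fun U : state R => U i j ^+ 2 / a)
   (2 * p i j * v i j / a).
  have dw := is_derive_coord i j p v.
  rewrite (_ : (fun U => _) = a^-1 *: (fun U : state R => U i j) ^+ 2); last first.
    by apply/funext => U; rewrite !fctE /GRing.scale/= mulrC.
  by apply: is_derive_eq; rewrite /GRing.scale/= expr1 -mulr_natl; ring.
apply/rowP => i; rewrite !mxE.
case: eqP => [->|ne].
  rewrite (_ : (fun U => _) = fun U => (sw U ^+ 2 / mu_w mu) / mobility mu U).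
    by have [_ ->] := is_derive_frac (sq 0 0 (mu_w mu)).
  by apply/funext => U; rewrite mxE.
rewrite (_ : (fun U => _) = fun U => (so U ^+ 2 / mu_o mu) / mobility mu U).
  by have [_ ->] := is_derive_frac (sq 0 1 (mu_o mu)).
by apply/funext => U; rewrite mxE; case: eqP.
Qed.

(** Along this direction the gas saturation is constant, and on the line the
    first variation of the mobility vanishes, because the two liquid
    contributions [sw / mu_w] and [so / mu_o] are equal there. *)
Definition dirT : state R := mk_state 1 (-1).

Let mobl_scaled_neq0 s :
  s ^+ 2 * mu_g mu + (mu_w mu + mu_o mu) * (1 - s) ^+ 2 != 0.
Proof.
have -> : s ^+ 2 * mu_g mu + (mu_w mu + mu_o mu) * (1 - s) ^+ 2
    = mu_g mu * mobl nu s by rewrite /mobl /nuG; field.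
by rewrite mulf_neq0 ?mobl_neq0.
Qed.

Lemma derive_flux_dirD s : 'D_dirD (flux mu) (L s) = lam_along nu s *: dirD.
Proof.
rewrite derive_flux mobility_line; have e1 := mobl_scaled_neq0 s.
rewrite /dmobility /dirD /sg /line_state !stateE /lam_along /mobl /nuG.
by apply: state_eq; rewrite !stateE; field; rewrite w0 o0 g0 wo0 e1.
Qed.

Lemma derive_flux_dirT s : 'D_dirT (flux mu) (L s) = lam_cross nu s *: dirT.
Proof.
rewrite derive_flux mobility_line; have e1 := mobl_scaled_neq0 s.
rewrite /dmobility /dirT /sg /line_state !stateE /lam_cross /mobl /nuG.
by apply: state_eq; rewrite !stateE; field; rewrite ?w0 ?o0 ?g0 ?wo0 ?e1.
Qed.

Lemma dir_decomp U : U = (sw U + so U) *: dirD +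
  ((sw U * mu_o mu - so U * mu_w mu) / (mu_w mu + mu_o mu)) *: dirT.
Proof.
by apply: state_eq; rewrite /dirD /dirT /line_state !stateE; field.
Qed.

Lemma dir_free (a b : R) : a *: dirD + b *: dirT = 0 -> a = 0 /\ b = 0.
Proof.
move=> e; have e1 : sw (a *: dirD + b *: dirT) = 0 by rewrite e /sw mxE.
have e2 : so (a *: dirD + b *: dirT) = 0 by rewrite e /so mxE.
move: e1 e2; rewrite /dirD /dirT /line_state !stateE => e1 e2.
have a0 : a = 0.
  have := congr2 +%R e1 e2; rewrite addr0 => <-; by field.
by move: e1; rewrite a0 mul0r add0r mulr1.
Qed.

(** The two directions form a basis of eigenvectors at every state of the line,
    including the umbilic point, where the eigenvalues coincide. *)
Lemma eigenvalues_line s : eigenvalues mu (L s) = [set lam_along nu s; lam_cross nu s].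
Proof.
have jE (v : state R) : v *m jacobian (flux mu) (L s) = 'D_v (flux mu) (L s).
  by rewrite deriveEjacobian//; exact: flux_differentiable.
rewrite eqEsubset; split=> [a /eigenvalueP[v va v0]|a [->|->]].
- move: va v0; rewrite [v]dir_decomp; set c := sw v + so v; set d := _ / _.
  rewrite mulmxDl -!scalemxAl !jE derive_flux_dirD derive_flux_dirT => /eqP.
  rewrite -subr_eq0 => /eqP va v0.
  have /dir_free[] : (c * (lam_along nu s - a)) *: dirD
      + (d * (lam_cross nu s - a)) *: dirT = 0.
    rewrite -{}va scalerDr !scalerA opprD addrACA -!scalerBl.
    by congr (_ *: _ + _ *: _); ring.
  move=> /eqP; rewrite mulf_eq0 => /orP[/eqP c0|]; last first.
    by rewrite subr_eq0 => /eqP <- _; left.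
  move=> /eqP; rewrite mulf_eq0 => /orP[/eqP d0|]; last first.
    by rewrite subr_eq0 => /eqP <-; right.
  by move: v0; rewrite c0 d0 !scale0r addr0 eqxx.
- apply/eigenvalueP; exists dirD; last exact: dirD_neq0.
  by rewrite jE derive_flux_dirD.
- apply/eigenvalueP; exists dirT; last first.
    apply/eqP => /(congr1 (@sw R)); rewrite /dirT stateE /sw mxE.
    by move/eqP; rewrite oner_eq0.
  by rewrite jE derive_flux_dirT.
Qed.

Lemma inf_pair (a b : R) : a <= b -> inf [set a; b] = a.
Proof.
move=> ab; apply/eqP; rewrite eq_le; apply/andP; split.
  apply: ge_inf; last by left.
  by exists a => x [->|->].
by apply: lb_le_inf; [exists a; left|move=> x [->|->]].
Qed.

Lemma sup_pair (a b : R) : a <= b -> sup [set a; b] = b.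
Proof.
move=> ab; apply/eqP; rewrite eq_le; apply/andP; split.
  by apply: ge_sup; [exists a; left|move=> x [->|->]].
apply: ub_le_sup; last by right.
by exists b => x [->|->].
Qed.

Lemma lambda_s_left x : 0 <= x <= sU nu -> lambda_s mu (L x) = lam_cross nu x.
Proof.
by move=> h; rewrite /lambda_s eigenvalues_line setUC inf_pair ?lam_cross_le_lam_along.
Qed.

Lemma lambda_f_left x : 0 <= x <= sU nu -> lambda_f mu (L x) = lam_along nu x.
Proof.
by move=> h; rewrite /lambda_f eigenvalues_line setUC sup_pair ?lam_cross_le_lam_along.
Qed.

Lemma lambda_s_right m : sU nu <= m -> lambda_s mu (L m) = lam_along nu m.
Proof.
by move=> h; rewrite /lambda_s eigenvalues_line inf_pair ?lam_along_le_lam_cross.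
Qed.

Lemma lambda_f_right m : sU nu <= m -> lambda_f mu (L m) = lam_cross nu m.
Proof.
by move=> h; rewrite /lambda_f eigenvalues_line sup_pair ?lam_along_le_lam_cross.
Qed.

(** * Shocks and end states on the line *)

Lemma is_derive_line (s : R -> R) (t ds : R) : is_derive t 1 s ds ->
  is_derive t 1 (fun t => L (s t)) (ds *: dirD).
Proof.
move=> sd; rewrite (_ : (fun t => _) = fun t => s t *: dirD); last first.
  by apply/funext => u; rewrite line_stateE.
have df : differentiable s t by apply/derivable1_diffP.
have dZ : differentiable (fun t => s t *: dirD) t by exact: differentiableZl.
apply: DeriveDef; first exact: diff_derivable.
by rewrite deriveE// diffZl// -deriveE// derive_val.
Qed.

Lemma line_shock x m : 0 <= x -> x < m <= 1 -> 0 <= collin nu x x m ->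
  shock mu (L x) (L m) (chord nu x m).
Proof.
move=> x0 xm txm; split; first exact: flux_line_sub.
have [s [s_itv ds sNy sy]] := heteroclinic nu1 x0 xm txm.
have lc := line_continuous.
exists (fun t => L (s t)); split.
- move=> t; apply/Omega_line; have /andP[xs sm] := s_itv t.
  by case/andP: xm => _ m1; rewrite !ltW ?(le_lt_trans x0)// (lt_le_trans sm).
- move=> t; apply: (is_derive_eq (is_derive_line (ds t))).
  by rewrite flux_line_sub -scalerBl line_state_sub scalerA mulrC.
- by apply: (@cvg_comp _ _ _ s L _ _ _ sNy); exact: lc.
- by apply: (@cvg_comp _ _ _ s L _ _ _ sy); exact: lc.
Qed.

Hypothesis nu8 : nu <= 8.

Lemma frakS_line m : sU nu < m <= 1 -> frakS mu (L m) = L (contact nu m).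
Proof.
move=> /andP[um m1]; have m0 : 0 < m by exact: lt_trans (sU_gt0 nu1) um.
have PU := contact_lt_sU nu1 um; have P0 := contact_gt0 nu1 m0.
apply: get_unique.
  split; first by apply/seg_GUP; exists (contact nu m); rewrite ?PU ?ltW.
  rewrite rh_speed_line ?lt_eqF// ?(lt_trans PU)// lambda_s_left ?ltW//=.
  by rewrite lam_cross_chord_contact.
move=> U /= [/seg_GUP[x /andP[x0 xU] ->]].
rewrite rh_speed_line ?lt_eqF// ?(lt_trans xU)// lambda_s_left ?x0 ?ltW// => /eqP.
by rewrite chord_eq_lam_cross// => /eqP->.
Qed.

Lemma pt_Y_param : param (pt_Y mu) = sY nu.
Proof. by rewrite /pt_Y param_line. Qed.

(** Below [sY] the condition is [contact x = m]; the root on the decreasing branch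
    of [contact] is the largest one.  Above [sY] the condition is the tangency
    equation, whose root is unique. *)
Lemma calF_line m : sU nu < m <= 1 ->
  exists2 x, fast_end nu x m & calF mu (L m) = L x.
Proof.
move=> um1; have /andP[um m1] := um1.
have [x xm] := fast_end_exists nu1 um1; exists x => //.
have /andP[dx xU] := fast_end_bounds nu1 nu8 um1 xm.
have x0 : 0 < x by exact: lt_le_trans (sD2_gt0 nu1) dx.
have U1 := sU_lt1 nu1.
rewrite /calF pt_Y_param param_line.
have [my|ym] := leP m (sY nu).
- have lowP U : calF_low mu (L m) U <->
      exists2 t, 0 <= t < sU nu /\ contact nu t = m & U = L t.
    split=> [[/seg_GUP[t /andP[t0 tU] ->]]|[t [/andP[t0 tU] tm] ->]].
      rewrite rh_speed_line ?lt_eqF// ?(lt_trans tU)// lambda_f_right ?ltW//.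
      move=> /eqP; rewrite chordC chord_eq_lam_cross// => /eqP e.
      by exists t; rewrite ?t0.
    split; first by apply/seg_GUP; exists t; rewrite ?t0.
    rewrite rh_speed_line ?lt_eqF// ?(lt_trans tU)// lambda_f_right ?ltW//.
    by apply/eqP; rewrite chordC chord_eq_lam_cross// tm.
  move: xm; rewrite /fast_end my => /andP[cx /eqP xm].
  have lowx : calF_low mu (L m) (L x).
    by apply/lowP; exists x => //; rewrite ltW.
  have maxx U : calF_low mu (L m) U -> param U <= param (L x).
    move=> /lowP[t [/andP[t0 tU] tm] ->]; rewrite !param_line leNgt.
    by apply/negP => xt; have := contact_lt nu1 cx xt; rewrite xm tm ltxx.
  apply: get_unique; first by split.
  move=> U /= [/[dup] lowU /lowP[t _ tE] maxU]; have := maxx _ lowU.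
  have := maxU _ lowx; rewrite tE !param_line => xt tx.
  by congr (L _); apply/eqP; rewrite eq_le tx.
- have highE t : 0 <= t < sU nu ->
      (rh_speed mu (L t) (L m) == lambda_f mu (L t)) = fast_end nu t m.
    move=> /andP[t0 tU]; have tm := lt_trans tU um.
    rewrite rh_speed_line; last by rewrite lt_eqF.
    rewrite lambda_f_left ?t0 ?(ltW tU)// chord_eq_lam_along//.
    by rewrite fast_end_unique_high ?t0 ?(ltW um) ?(ltW (lt_trans tU U1)).
  apply: get_unique.
    split; first by apply/seg_GUP; exists x; rewrite ?(ltW x0).
    by apply/eqP; rewrite highE// ltW.
  move=> U [/seg_GUP[t tU ->]] /eqP; rewrite highE//.
  by move: xm; rewrite /fast_end leNgt ym/= => /eqP -> /eqP ->.
Qed.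

Lemma SCB_pairsE : SCB_pairs mu =
  [set (L (contact nu m), L m) | m in [set m | sU nu < m <= 1]].
Proof.
rewrite /SCB_pairs eqEsubset; split=> [[U V] /=|_ [m /= um1 <-]].
- move=> [GU /seg_UDP[m um1 ->] [_ _ e _]]; exists m => //; congr (_, _).
  rewrite -frakS_line//; apply: get_unique => //.
  move=> W [/seg_GUP[t /andP[t0 tU] ->]].
  have /andP[um m1] := um1.
  rewrite rh_speed_line ?lt_eqF// ?(lt_trans tU)// lambda_s_left ?t0 ?ltW// => /eqP.
  rewrite chord_eq_lam_cross// => /eqP->; move: GU e => /seg_GUP[x /andP[x0 xU] ->].
  rewrite rh_speed_line ?lt_eqF// ?(lt_trans xU)// lambda_s_left ?x0 ?ltW// => /eqP.
  by rewrite chord_eq_lam_cross// => /eqP->.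
- have /andP[um m1] := um1; have m0 : 0 < m by exact: lt_trans (sU_gt0 nu1) um.
  have PU := contact_lt_sU nu1 um; have P0 := contact_gt0 nu1 m0.
  have Pm := lt_trans PU um.
  have speed := lam_cross_chord_contact nu1 m.
  split=> /=; first by apply/seg_GUP; exists (contact nu m); rewrite ?PU ?ltW.
    by apply/seg_UDP; exists m.
  rewrite rh_speed_line ?lt_eqF//; split.
  + by apply: line_shock; rewrite ?Pm// ltW// collin_contact_contact_gt0.
  + rewrite lambda_s_right ?ltW// lam_along_lt_chord// collinA collinC.
    rewrite collin_contact_gt0 ?ltW//.
    by rewrite (lt_trans (sCY_lt_sU nu1)).
  + by rewrite lambda_s_left ?speed// !ltW.
  + by rewrite lambda_f_right ?ltW// -speed lam_cross_contact_lt.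
Qed.

(** A right state beyond [sY] would give a chord tangent on the left with the
    transversal speed of m, but [collin_contact] allows this at [sCY] only.  The
    same sign excludes [sCY] itself, where the inequality with the left fast
    speed degenerates to an equality. *)
Lemma FCB_pairsE : FCB_pairs mu =
  [set (L x, L (contact nu x)) | x in [set x | sCY nu < x < sU nu]].
Proof.
rewrite /FCB_pairs eqEsubset; split=> [[U V] /=|_ [x /= /andP[cx xU] <-]].
- move=> [_ /seg_UDP[m um1 ->] UE [_ e lt_f _]]; have /andP[um m1] := um1.
  have [x xm FE] := calF_line um1; move: e lt_f; rewrite UE FE.
  have /andP[dx xU] := fast_end_bounds nu1 nu8 um1 xm.
  have x0 : 0 < x by exact: lt_le_trans (sD2_gt0 nu1) dx.
  have xm' := lt_trans xU um.
  rewrite rh_speed_line ?lt_eqF// lambda_f_right ?ltW// lambda_f_left ?ltW//.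
  move=> /eqP; rewrite eq_sym chordC chord_eq_lam_cross// => /eqP mE.
  rewrite chordC chord_lt_lam_along// {1}mE collin_contact_gt0 ?ltW// => cx.
  by exists x; rewrite ?cx// -mE.
- have x0 : 0 < x := lt_trans (sCY_gt0 nu1) cx.
  have x0U : 0 < x < sU nu by rewrite x0.
  have um : sU nu < contact nu x.
    by rewrite -[ltLHS](contact_sU nu1) contact_lt// ltW.
  have my : contact nu x < sY nu by rewrite contact_lt_sCY// gt_eqF.
  have m1 : contact nu x <= 1 by rewrite ltW// (lt_le_trans my)// sY_le1.
  have um1 : sU nu < contact nu x <= 1 by rewrite um.
  have xm := contact_gt_id nu1 x0U.
  have speed : chord nu x (contact nu x) = lam_cross nu (contact nu x).
    by rewrite lam_cross_chord_contact// chordC.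
  have tx : 0 < collin nu x x (contact nu x) by rewrite collin_contact_gt0 ?ltW.
  split=> /=.
  + by apply/seg_GUP; exists x; rewrite ?xU ?ltW.
  + by apply/seg_UDP; exists (contact nu x).
  + have [y yf ->] := calF_line um1; congr (L _); move: yf.
    rewrite /fast_end (ltW my) => /andP[cy /eqP yE].
    by have [h|h|//] := ltgtP x y; [have := contact_lt nu1 (ltW cx) h|
      have := contact_lt nu1 cy h]; rewrite yE ltxx.
  rewrite rh_speed_line ?lt_eqF//; split.
  + by apply: line_shock; rewrite ?xm// ltW.
  + by rewrite lambda_f_right ?ltW.
  + by rewrite lambda_f_left ?ltW// chord_lt_lam_along.
  + by rewrite lambda_s_left ?ltW// speed lam_cross_lt_contact.
Qed.

(** Up to [sY] the speed equals the fast speed of the right state, against the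
    strict inequality required of the shock; so only tangent chords remain. *)
Lemma UCB_pairsE : UCB_pairs mu =
  [set (L (tangent nu m), L m) | m in [set m | sY nu < m <= 1]].
Proof.
have Uy := sU_lt_sY nu1.
rewrite /UCB_pairs eqEsubset; split=> [[U V] /=|_ [m /= /andP[ym m1] <-]].
- move=> [_ /seg_UDP[m um1 ->] UE [_ [_ e] /andP[_ lt_f]]].
  have /andP[um m1] := um1.
  have [x xm FE] := calF_line um1; move: e lt_f; rewrite UE FE.
  have /andP[dx xU] := fast_end_bounds nu1 nu8 um1 xm.
  have x0 : 0 < x by exact: lt_le_trans (sD2_gt0 nu1) dx.
  have xm' := lt_trans xU um.
  rewrite rh_speed_line ?lt_eqF// (lambda_f_right (ltW um)).
  move=> _; rewrite fast_end_speed// => lt_f.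
  have [my|ym] := leP m (sY nu).
    by move: lt_f; rewrite upper_plus_low ?ltxx// (ltW um).
  exists m; first by rewrite ym.
  by move: xm; rewrite /fast_end leNgt ym/= => /eqP->.
- have um : sU nu < m by exact: lt_trans ym.
  have um1 : sU nu < m <= 1 by rewrite um.
  have xf : fast_end nu (tangent nu m) m by rewrite /fast_end leNgt ym/=.
  have := fast_end_bounds nu1 nu8 um1 xf; set x := tangent nu m in xf *.
  move=> /andP[_ xU].
  have x0 : 0 < x := tangent_gt0 nu1 m.
  have xm : x < m := lt_trans xU um.
  have tx : collin nu x x m = 0 := collin_tangent nu1 m.
  have speed : chord nu x m = lam_along nu x by apply/eqP; rewrite chord_eq_lam_along ?tx.
  have xP : x < contact nu m by exact: tangent_lt_contact.
  split=> /=.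
  + by apply/seg_GUP; exists x; rewrite ?xU ?ltW.
  + by apply/seg_UDP; exists m.
  + have [y yf ->] := calF_line um1; congr (L _); move: yf.
    by rewrite /fast_end leNgt ym/= => /eqP->.
  rewrite rh_speed_line ?lt_eqF//; split.
  + by apply: line_shock; rewrite ?xm ?tx// ltW.
  + by rewrite lambda_f_left ?ltW// lambda_s_left ?ltW// lam_cross_lt_chord.
  + rewrite lambda_s_right ?ltW// lambda_f_right ?ltW// lam_along_lt_chord//.
    rewrite -tx collin_near_lt ?x0//=; last 2 first.
    * by rewrite ltW// (lt_trans xU)// sU_lt1.
    * by rewrite m1 ltW// (lt_trans x0).
    rewrite chord_lt_lam_cross// (le_lt_trans _ ym)// contact_le_sY//.
Qed.

Lemma GUB_pairsE : GUB_pairs mu =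
  [set (L u, L 1) | u in [set u | sD2 nu < u < sD1 nu]].
Proof.
have U1 : sU nu < (1 : R) <= 1 by rewrite sU_lt1/=.
have [y /(fast_end1 nu1 nu8)-> FE] := calF_line U1.
rewrite /GUB_pairs eqEsubset; split=> [[U V] /=|_ [u /= /andP[du uD] <-]].
- move=> [/segmentP[u _ ->] -> ]; rewrite /pt_D FE frakS_line// contact1// !param_line.
  by move=> h; exists u.
- have u1 : u < 1 by rewrite (lt_trans uD)// (lt_trans (sD1_lt_sU nu1))// sU_lt1.
  split=> //=; last by rewrite /pt_D FE frakS_line// contact1// !param_line du.
  by apply/segmentP; exists u => //; rewrite !ltW// (lt_trans (sD2_gt0 nu1)).
Qed.

(** * The surface in the two charts *)

Definition chart_minus : set (R * R) :=
  [set p | sD2 nu <= p.1 < sU nu /\ lower_minus nu p.1 <= p.2 <= upper_minus nu p.1].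

Definition chart_plus : set (R * R) :=
  [set p | sU nu < p.1 <= 1 /\ lower_plus nu p.1 <= p.2 <= upper_plus nu p.1].

Lemma plane_chart_inj : injective (plane_chart mu).
Proof. by move=> [s v] [t w] [/line_state_inj-> ->]. Qed.

Lemma T_minusE : T_minus mu = plane_chart mu @` chart_minus.
Proof.
rewrite eqEsubset; split=> [p [M /seg_UDP[m um1 ->] [U /segmentP[u u01 ->]]]|].
- have [x xm ->] := calF_line um1.
  rewrite frakS_line// !param_line => -[]; rewrite fast_end_joinable//.
  move=> /andP[du ju ->]; have /and3P[_ _ uP] := ju.
  have /andP[um m1] := um1.
  have uU : u < sU nu by exact: le_lt_trans uP (contact_lt_sU nu1 um).
  exists (u, chord nu u m); last first.
    by rewrite /plane_chart/= rh_speed_line// lt_eqF// (lt_trans uU).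
  by apply/(speed_range_minus nu1 nu8); exists m.
- move=> _ [[u v] /(@speed_range_minus _ _ nu1 nu8 u v)[m um1 [du uU ju ->]] <-].
  have /andP[um m1] := um1.
  exists (L m); first by apply/seg_UDP; exists m.
  have [x xm FE] := calF_line um1; exists (L u).
    apply/segmentP; exists u => //.
    by rewrite (le_trans (ltW (sD2_gt0 nu1)) du) ltW// (lt_trans uU)// sU_lt1.
  rewrite FE frakS_line// !param_line fast_end_joinable// du ju; split=> //.
  by rewrite /plane_chart/= rh_speed_line// lt_eqF// (lt_trans uU).
Qed.

Lemma T_plusE : T_plus mu = plane_chart mu @` chart_plus.
Proof.
have speeds m : sU nu < m <= 1 ->
    sigma_S mu (L m) = lower_plus nu m /\ sigma_F mu (L m) = upper_plus nu m.
  move=> um1; have /andP[um m1] := um1.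
  have [x xm FE] := calF_line um1.
  have /andP[_ xU] := fast_end_bounds nu1 nu8 um1 xm.
  rewrite /sigma_S /sigma_F FE frakS_line//.
  rewrite (@rh_speed_line x m); last by rewrite lt_eqF// (lt_trans xU).
  rewrite rh_speed_line; last by rewrite lt_eqF// (lt_trans (contact_lt_sU nu1 um)).
  by rewrite (fast_end_speed nu1 nu8 um1 xm) /lower_plus lam_cross_chord_contact.
rewrite eqEsubset; split=> [p [M /seg_UDP[m um1 ->] [v]]|_ [[m v] /= [um1 vm] <-]].
- by have [-> ->] := speeds _ um1 => vm ->; exists (m, v).
- exists (L m); first by apply/seg_UDP; exists m.
  by exists v => //; have [-> ->] := speeds _ um1.
Qed.

Lemma plane_boundaryE (B : set (R * R)) :
  plane_boundary mu (plane_chart mu @` B)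
  = plane_chart mu @` (closure B `\` interior B).
Proof.
rewrite /plane_boundary; have -> // : plane_chart mu @^-1` (plane_chart mu @` B) = B.
by rewrite eqEsubset; split=> [p [q Bq /plane_chart_inj <-]//|p Bp]; exists p.
Qed.

(** * The boundary curves as graphs *)

(** The curves are half-open or open depending on which strict inequalities of
    the shock conditions fail at their ends; adding the ends makes this
    irrelevant. *)
Lemma with_ends_segment {T : Type} (c : R -> T) (a b : R) (A : set T) : a <= b ->
  A `<=` c @` `[a, b] -> (forall t, a < t < b -> A (c t)) ->
  A `|` [set c a; c b] = c @` `[a, b].
Proof.
move=> ab AI IA; rewrite eqEsubset; split=> [z [/AI//|[->|->]]|_ [t + <-]].
- by exists a => //; rewrite /= in_itv/= lexx.
- by exists b => //; rewrite /= in_itv/= lexx ab.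
rewrite /= in_itv/= => /andP[at_ tb].
have [->|ta] := eqVneq t a; first by right; left.
have [->|tb'] := eqVneq t b; first by right; right.
by left; apply: IA; rewrite !lt_neqAle [a == t]eq_sym ta tb' at_ tb.
Qed.

Lemma with_endsC (A : set (state R * R)) p q : with_ends A p q = with_ends A q p.
Proof. by rewrite /with_ends setUC [X in X `|` _]setUC [LHS]setUC. Qed.

Definition graph (h : R -> R) (a b : R) : set (state R * R) :=
  (fun t => (L t, h t)) @` `[a, b].

Lemma graph_arc (h : R -> R) (a b : R) : a <= b -> continuous h ->
  arc_from_to (graph h a b) (L a, h a) (L b, h b) /\
  arc_from_to (graph h a b) (L b, h b) (L a, h a).
Proof.
move=> ab ch; apply: (@arc_of_segment _ (fun t => (L t, h t))) => //.
  by apply: pair_continuous => //; exact: line_continuous.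
by move=> s t _ _ /= [/line_state_inj].
Qed.

Let D2U := sD2_lt_sU nu1 nu8.
Let D1U := sD1_lt_sU nu1.
Let D21 := sD2_lt_sD1 nu1.
Let D2c := sD2_le_sCY nu1 nu8.
Let cU := sCY_lt_sU nu1.
Let Uy := sU_lt_sY nu1.
Let y1 := sY_le1 nu1 nu8.
Let U1 : sU nu < 1 := sU_lt1 nu1.
Let D20 := sD2_gt0 nu1.

Lemma D1_hatE : D1_hat mu = (L (sD1 nu), lam_cross nu (sD1 nu)).
Proof.
rewrite /D1_hat /pt_D1 /pt_D rh_speed_line ?lt_eqF ?(lt_trans D1U)//.
by rewrite -/(sD1 nu) -(contact1 nu) lam_cross_chord_contact.
Qed.

Lemma U_hatE : U_hat mu = (L (sU nu), lam_cross nu (sU nu)).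
Proof. by rewrite /U_hat umbilicE lam_cross_sU//. Qed.

Lemma D_hatE : D_hat mu = (L 1, lam_cross nu (contact nu 1)).
Proof. by rewrite /D_hat -[rh_speed _ _ _]/(D1_hat mu).2 D1_hatE contact1//. Qed.

Lemma D2_hatE : D2_hat mu = (L (sD2 nu), lam_along nu (sD2 nu)).
Proof.
rewrite /D2_hat /pt_D2 /pt_D rh_speed_line ?lt_eqF ?(lt_trans D2U)//.
by rewrite -/(sD2 nu) lam_along_sD2.
Qed.

Lemma D_checkE : D_check mu = (L 1, chord nu (tangent nu 1) 1).
Proof.
rewrite /D_check -[rh_speed _ _ _]/(D2_hat mu).2 D2_hatE.
by rewrite tangent1// lam_along_sD2.
Qed.

Lemma calY_hatE : calY_hat mu = (L (sCY nu), lam_cross nu (contact nu (sCY nu))).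
Proof.
rewrite /calY_hat /calY /pt_Y -/(sCY nu) -/(sY nu).
rewrite rh_speed_line ?lt_eqF ?(lt_trans cU)// -contact_sCY//.
by rewrite lam_cross_chord_contact// chordC.
Qed.

Lemma Y_hatE : Y_hat mu = (L (sY nu), lam_cross nu (sY nu)).
Proof.
rewrite /Y_hat -[rh_speed _ _ _]/(calY_hat mu).2 calY_hatE.
by rewrite contact_sCY//.
Qed.

Lemma SCBm_graph :
  with_ends (left_curve mu (SCB_pairs mu)) (D1_hat mu) (U_hat mu)
  = graph (lam_cross nu) (sD1 nu) (sU nu).
Proof.
rewrite D1_hatE U_hatE; apply: (with_ends_segment (ltW D1U)).
- rewrite SCB_pairsE => _ [_ [m /= um1 <-] <-] /=; have /andP[um m1] := um1.
  have Pm := contact_lt_sU nu1 um.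
  exists (contact nu m); first by rewrite /= in_itv/= sD1_le_contact// ltW.
  by rewrite rh_speed_line ?lt_eqF ?(lt_trans Pm)// lam_cross_chord_contact.
- move=> t /andP[dt tU]; have [|m um1 mt] := @contact_onto_slow _ nu nu1 t.
    by rewrite ltW.
  have /andP[um m1] := um1.
  exists (L (contact nu m), L m); first by rewrite SCB_pairsE; exists m.
  rewrite /= rh_speed_line; last by rewrite lt_eqF// mt (lt_trans tU).
  by rewrite -lam_cross_chord_contact// mt.
Qed.

Lemma SCBp_graph :
  with_ends (right_curve mu (SCB_pairs mu)) (U_hat mu) (D_hat mu)
  = graph (lower_plus nu) (sU nu) 1.
Proof.
have -> : U_hat mu = (L (sU nu), lower_plus nu (sU nu)).
  by rewrite /lower_plus contact_sU// U_hatE.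
rewrite D_hatE.
apply: (@with_ends_segment _ (fun m => (L m, lower_plus nu m)) _ _ _ (ltW U1)).
- rewrite SCB_pairsE => _ [_ [m /= um1 <-] <-] /=; have /andP[um m1] := um1.
  exists m; first by rewrite /= in_itv/= ltW.
  rewrite rh_speed_line ?lt_eqF ?(lt_trans (contact_lt_sU nu1 um))//.
  by rewrite /lower_plus lam_cross_chord_contact.
- move=> m /andP[um m1]; exists (L (contact nu m), L m).
    by rewrite SCB_pairsE; exists m => //=; rewrite um ltW.
  rewrite /= rh_speed_line; last by rewrite lt_eqF// (lt_trans (contact_lt_sU nu1 um)).
  by rewrite -lam_cross_chord_contact.
Qed.

Lemma rh_speed_contact x : 0 < x < sU nu ->
  rh_speed mu (L x) (L (contact nu x)) = lam_cross nu (contact nu x).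
Proof.
move=> xU; rewrite rh_speed_line ?lt_eqF ?contact_gt_id//.
by rewrite lam_cross_chord_contact// chordC.
Qed.

Lemma rh_speed_D u : u < sD1 nu -> rh_speed mu (L u) (L 1) = chord nu u 1.
Proof.
by move=> uD; rewrite rh_speed_line ?lt_eqF// (lt_trans uD)// (lt_trans D1U).
Qed.

Lemma FCBm_graph :
  with_ends (left_curve mu (FCB_pairs mu)) (calY_hat mu) (U_hat mu)
  = graph (fun t => lam_cross nu (contact nu t)) (sCY nu) (sU nu).
Proof.
have speed := rh_speed_contact.
have -> : U_hat mu = (L (sU nu), lam_cross nu (contact nu (sU nu))).
  by rewrite contact_sU// U_hatE.
rewrite calY_hatE.
apply: (@with_ends_segment _ (fun t => (L t, lam_cross nu (contact nu t)))
  _ _ _ (ltW cU)).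
- rewrite FCB_pairsE => _ [_ [x /= /andP[cx xU] <-] <-] /=.
  exists x; first by rewrite /= in_itv/= !ltW.
  by rewrite speed// xU (lt_trans _ cx)// sCY_gt0.
- move=> x /andP[cx xU]; exists (L x, L (contact nu x)).
    by rewrite FCB_pairsE; exists x => //=; rewrite cx.
  by rewrite /= speed// xU (lt_trans _ cx)// sCY_gt0.
Qed.

Lemma FCBp_graph :
  with_ends (right_curve mu (FCB_pairs mu)) (U_hat mu) (Y_hat mu)
  = graph (lam_cross nu) (sU nu) (sY nu).
Proof.
have speed := rh_speed_contact.
rewrite Y_hatE U_hatE; apply: (with_ends_segment (ltW Uy)).
- rewrite FCB_pairsE => _ [_ [x /= /andP[cx xU] <-] <-] /=.
  have x0 : 0 < x by rewrite (lt_trans _ cx)// sCY_gt0.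
  exists (contact nu x); last by rewrite speed// x0.
  rewrite /= in_itv/= contact_le_sY// andbT -[leLHS](contact_sU nu1).
  by rewrite contact_le// ltW.
- move=> m /andP[um my]; have [|x /andP[cx xU] xm] := @contact_onto_fast _ nu nu1 m.
    by rewrite um ltW.
  have x0 : 0 < x by rewrite (lt_le_trans _ cx)// sCY_gt0.
  exists (L x, L (contact nu x)); last by rewrite /= speed ?x0// xm.
  rewrite FCB_pairsE; exists x => //=; rewrite xU andbT lt_neqAle cx andbT.
  by apply/eqP => xE; move: my; rewrite -xm -xE contact_sCY// ltxx.
Qed.

Lemma UCBm_graph :
  with_ends (left_curve mu (UCB_pairs mu)) (D2_hat mu) (calY_hat mu)
  = graph (lam_along nu) (sD2 nu) (sCY nu).
Proof.
have speed m : sY nu < m <= 1 ->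
    rh_speed mu (L (tangent nu m)) (L m) = lam_along nu (tangent nu m).
  move=> ym; have xm : tangent nu m < m.
    case/andP: (ym) => ym' _; apply: lt_trans ym'.
    by rewrite (lt_trans (tangent_lt_sCY nu1 ym))// (lt_trans cU).
  by rewrite rh_speed_line ?lt_eqF//; apply/eqP; rewrite chord_eq_lam_along// collin_tangent.
have -> : calY_hat mu = (L (sCY nu), lam_along nu (sCY nu)).
  rewrite calY_hatE lam_cross_chord_contact// chordC; congr (_, _); apply/eqP.
  rewrite chord_eq_lam_along ?contact_sCY ?collin_sCY//.
  exact: lt_trans Uy.
rewrite D2_hatE; apply: (with_ends_segment D2c).
- rewrite UCB_pairsE => _ [_ [m /= ym <-] <-] /=.
  exists (tangent nu m); last by rewrite speed.
  rewrite /= in_itv/= (ltW (tangent_lt_sCY nu1 ym)) andbT.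
  by case/andP: ym => ym m1; rewrite sD2_le_tangent// m1 ltW// (lt_trans Uy).
- move=> x /andP[dx xc]; have [|m ym mx] := @tangent_onto _ nu nu1 nu8 x.
    by rewrite ltW.
  exists (L (tangent nu m), L m); last by rewrite /= speed// mx.
  by rewrite UCB_pairsE; exists m.
Qed.

(** For [sY = 1] there is no shock of this kind and both sides are the point
    over D. *)
Lemma UCBp_graph :
  with_ends (right_curve mu (UCB_pairs mu)) (D_check mu) (Y_hat mu)
  = graph (fun m => chord nu (tangent nu m) m) (sY nu) 1.
Proof.
have speed m : sY nu < m <= 1 ->
    rh_speed mu (L (tangent nu m)) (L m) = chord nu (tangent nu m) m.
  move=> ym; rewrite rh_speed_line ?lt_eqF//.
  case/andP: (ym) => ym' _; apply: lt_trans ym'.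
  by rewrite (lt_trans (tangent_lt_sCY nu1 ym))// (lt_trans cU).
have -> : Y_hat mu = (L (sY nu), chord nu (tangent nu (sY nu)) (sY nu)).
  by rewrite Y_hatE tangent_sY// -contact_sCY// lam_cross_chord_contact// chordC.
rewrite with_endsC D_checkE.
apply: (@with_ends_segment _ (fun m => (L m, chord nu (tangent nu m) m)) _ _ _ y1).
- rewrite UCB_pairsE => _ [_ [m /= ym <-] <-] /=; exists m; last by rewrite speed.
  by rewrite /= in_itv/= ltW//; case/andP: ym.
- move=> m /andP[ym m1]; have ym1 : sY nu < m <= 1 by rewrite ym ltW.
  exists (L (tangent nu m), L m); last by rewrite /= speed.
  by rewrite UCB_pairsE; exists m.
Qed.

Lemma GUBm_graph :
  with_ends (left_curve mu (GUB_pairs mu)) (D2_hat mu) (D1_hat mu)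
  = graph (fun u => chord nu u 1) (sD2 nu) (sD1 nu).
Proof.
have speed := rh_speed_D.
rewrite D2_hatE lam_along_sD2// D1_hatE -{2}contact1 lam_cross_chord_contact// contact1.
apply: (@with_ends_segment _ (fun u => (L u, chord nu u 1)) _ _ _ (ltW D21)).
- rewrite GUB_pairsE => _ [_ [u /= /andP[du uD] <-] <-] /=.
  by exists u; rewrite ?speed//= in_itv/= !ltW.
- move=> u /andP[du uD]; exists (L u, L 1); last by rewrite /= speed.
  by rewrite GUB_pairsE; exists u => //=; rewrite du.
Qed.

Definition vertical (a b : R) : set (state R * R) :=
  (fun v => (L 1, v)) @` `[a, b].

(** All these right states are D, so the curve is a vertical side of the band. *)
Lemma GUBp_vertical :
  with_ends (right_curve mu (GUB_pairs mu)) (D_check mu) (D_hat mu)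
  = vertical (lower_plus nu 1) (upper_plus nu 1).
Proof.
have speed := rh_speed_D.
have D11 : sD1 nu < 1 by exact: lt_trans U1.
have loE : lam_cross nu (contact nu 1) = chord nu (sD1 nu) 1.
  by rewrite lam_cross_chord_contact// contact1.
have hiE : upper_plus nu 1 = chord nu (sD2 nu) 1.
  have U11 : sU nu < (1 : R) <= 1 by rewrite U1/=.
  have [x x1 _] := calF_line U11.
  by rewrite -(fast_end_speed nu1 nu8 U11 x1) (fast_end1 nu1 nu8 x1).
rewrite with_endsC D_hatE D_checkE tangent1// /vertical /lower_plus hiE loE.
apply: (@with_ends_segment _ (fun v => (L 1, v))).
- by rewrite chord1_le// ltW.
- rewrite GUB_pairsE => _ [_ [u /= /andP[du uD] <-] <-] /=.
  exists (chord nu u 1); last by rewrite speed.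
  by rewrite /= in_itv/= !chord1_le// ltW// (lt_trans uD).
- move=> v /andP[v1 v2].
  have [||u] := @IVT R (fun u => chord nu u 1) (sD2 nu) (sD1 nu) v (ltW D21).
  + apply/continuous_subspaceT/(chord_comp_continuous nu1); first exact: continuous_id.
    exact: continuous_cst.
  + by rewrite ge_min le_max (ltW v1) (ltW v2) orbT.
  rewrite in_itv/= => /andP[du uD] uv.
  have du' : sD2 nu < u.
    by rewrite lt_neqAle du andbT; apply/eqP => e; move: v2; rewrite -uv e ltxx.
  have uD' : u < sD1 nu.
    by rewrite lt_neqAle uD andbT; apply/eqP => e; move: v1; rewrite -uv e ltxx.
  exists (L u, L 1); last by rewrite /= speed// uv.
  by rewrite GUB_pairsE; exists u => //=; rewrite du'.
Qed.

(** * Boundaries of the surface *)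

Lemma lower_minus_continuous : continuous (lower_minus nu).
Proof.
move=> u; apply: (@continuous_max R R (fun u => chord nu u 1) (lam_cross nu) u).
  exact: (chord_comp_continuous nu1 (@continuous_id R) (@continuous_cst R 1)).
exact: lam_cross_continuous.
Qed.

Lemma lam_cross_contact_continuous : continuous (fun t => lam_cross nu (contact nu t)).
Proof.
move=> u; apply: (@continuous_comp R R R (contact nu) (lam_cross nu) u).
  exact: contact_continuous.
exact: lam_cross_continuous.
Qed.

Lemma chord_tangent_continuous : continuous (fun m => chord nu (tangent nu m) m).
Proof.
exact: (chord_comp_continuous nu1 (tangent_continuous nu1) (@continuous_id R)).
Qed.

Lemma upper_minus_continuous : continuous (upper_minus nu).
Proof.
move=> u; apply: (@continuous_min R R (lam_along nu)
  (fun t => lam_cross nu (contact nu t)) u).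
  exact: lam_along_continuous.
exact: lam_cross_contact_continuous.
Qed.

Lemma upper_plus_continuous : continuous (upper_plus nu).
Proof.
move=> m; apply: (@continuous_min R R (lam_cross nu)
  (fun m => chord nu (tangent nu m) m) m).
  exact: lam_cross_continuous.
exact: chord_tangent_continuous.
Qed.

Lemma graph_eq (f h : R -> R) a b : (forall t, a <= t <= b -> f t = h t) ->
  graph f a b = graph h a b.
Proof.
move=> fh; rewrite eqEsubset; split=> _ [t tab <-]; exists t => //;
  by rewrite fh//; move: tab; rewrite /= in_itv.
Qed.

Lemma graph_cat (h : R -> R) a b c : a <= b -> b <= c ->
  graph h a c = graph h a b `|` graph h b c.
Proof.
move=> ab bc; rewrite eqEsubset; split=> [_ [t + <-]|_ [|] [t + <-]];
  rewrite /= in_itv/= => /andP[t1 t2].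
- have [tb|bt] := leP t b; [left|right]; exists t => //; rewrite /= in_itv/=.
    by rewrite t1.
  by rewrite (ltW bt).
- by exists t; rewrite //= in_itv/= t1 (le_trans t2).
- by exists t; rewrite //= in_itv/= t2 (le_trans ab).
Qed.

Lemma image_graph (h : R -> R) a b :
  plane_chart mu @` [set (s, h s) | s in `[a, b]] = graph h a b.
Proof. by rewrite image_comp. Qed.

(** The vertical sides over [sD2] and [sU] are single points, because the
    bounding graphs meet there; each graph breaks where its two defining
    functions cross. *)
Lemma T_minus_boundary : plane_boundary mu (T_minus mu) =
  graph (lam_cross nu) (sD1 nu) (sU nu) `|`
  graph (fun t => lam_cross nu (contact nu t)) (sCY nu) (sU nu) `|`
  graph (lam_along nu) (sD2 nu) (sCY nu) `|`
  graph (fun u => chord nu u 1) (sD2 nu) (sD1 nu).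
Proof.
rewrite T_minusE plane_boundaryE.
rewrite (band_boundary lower_minus_continuous upper_minus_continuous D2U
  (lower_minus_le_upper_minus nu1 nu8)).
- rewrite !image_setU !image_graph.
  rewrite (graph_cat _ (ltW D21) (ltW D1U)) (graph_cat _ D2c (ltW cU)).
  rewrite (@graph_eq (lower_minus nu) (fun u => chord nu u 1) (sD2 nu)); last first.
    by move=> t /andP[_ h]; rewrite lower_minus_low.
  rewrite (@graph_eq (lower_minus nu) (lam_cross nu) (sD1 nu)); last first.
    by move=> t /andP[h _]; rewrite lower_minus_high.
  rewrite (@graph_eq (upper_minus nu) (lam_along nu) (sD2 nu)); last first.
    by move=> t /andP[h1 h2]; rewrite upper_minus_low// h2 (lt_le_trans D20).
  rewrite (@graph_eq (upper_minus nu) (fun t => lam_cross nu (contact nu t))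
    (sCY nu)); last first.
    by move=> t h; rewrite upper_minus_high.
  rewrite -[upper_minus nu (sD2 nu)]lower_minus_eq_upper_minus_sD2//.
  rewrite upper_minus_sU// lower_minus_sU//.
  rewrite !set_itv1 !image_set1.
  rewrite eqEsubset; split=> p.
  + move=> [[[[|]|[|]]|]|].
    * by right.
    * by left; left; left.
    * by left; right.
    * by left; left; right.
    * move=> ->; right; exists (sD2 nu); first by rewrite /= in_itv/= lexx ltW.
      by rewrite /plane_chart/= lower_minus_low// ltW.
    * move=> ->; left; left; left; exists (sU nu); last by rewrite lam_cross_sU.
      by rewrite /= in_itv/= lexx ltW.
  + by move=> [[[|]|]|] h; left; left; [left; right|right; right|right; left|left; left].
- by move=> [s v] [/= /andP[ds sU'] ?]; split=> //=; rewrite ds ltW.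
- by move=> s v /andP[ds sU'] ?; split=> //=; rewrite sU' ltW.
Qed.

(** The bounding graphs meet at the umbilic point; the vertical side over D is
    GUB. *)
Lemma T_plus_boundary : plane_boundary mu (T_plus mu) =
  graph (lower_plus nu) (sU nu) 1 `|`
  graph (lam_cross nu) (sU nu) (sY nu) `|`
  graph (fun m => chord nu (tangent nu m) m) (sY nu) 1 `|`
  vertical (lower_plus nu 1) (upper_plus nu 1).
Proof.
rewrite T_plusE plane_boundaryE.
rewrite (band_boundary (lam_cross_contact_continuous : continuous (lower_plus nu))
  upper_plus_continuous U1
  (lower_plus_le_upper_plus nu1 nu8)).
- rewrite !image_setU !image_graph.
  rewrite (graph_cat (upper_plus nu) (ltW Uy) y1).
  rewrite (@graph_eq (upper_plus nu) (lam_cross nu) (sU nu)); last first.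
    by move=> t h; rewrite upper_plus_low.
  rewrite (@graph_eq (upper_plus nu) (fun m => chord nu (tangent nu m) m)
    (sY nu)); last first.
    move=> t /andP[]; rewrite le_eqVlt => /predU1P[<- _|h _]; last first.
      by rewrite upper_plus_high.
    rewrite upper_plus_low//; last by rewrite lexx ltW.
    rewrite tangent_sY//.
    by rewrite -contact_sCY// lam_cross_chord_contact// chordC.
  rewrite upper_plus_sU// lower_plus_sU//.
  rewrite !set_itv1 !image_set1 image_comp -/(vertical _ _).
  rewrite eqEsubset; split=> p.
  + move=> [[[|[|]]|]|].
    * by left; left; left.
    * by left; left; right.
    * by left; right.
    * move=> ->; left; left; right; exists (sU nu); last by rewrite lam_cross_sU.
      by rewrite /= in_itv/= lexx ltW.
    * by right.
  + move=> [[[|]|]|] h; [left; left; left|left; left; right; left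
      |left; left; right; right|right]; exact: h.
- by move=> [s v] [/= /andP[us s1] ?]; split=> //=; rewrite s1 ltW.
- by move=> s v /andP[us s1] ?; split=> //=; rewrite us ltW.
Qed.

(** The surface omits the abscissa [sU], which a bounding graph reaches only at the
    lifted umbilic point. *)
Lemma graph_minus_sub h a b : sD2 nu <= a -> b <= sU nu -> h (sU nu) = 2 \/ b < sU nu ->
  (forall t, a <= t <= b -> lower_minus nu t <= h t <= upper_minus nu t) ->
  graph h a b `\ U_hat mu `<=` T_minus mu.
Proof.
move=> da bU hU hlu; rewrite T_minusE => _ [[t + <-]].
rewrite /= in_itv/= => tab tU; exists (t, h t) => //.
have /andP[at_ tb] := tab.
split=> /=; last exact: hlu.
rewrite (le_trans da at_) lt_neqAle (le_trans tb bU) andbT; apply/eqP => tE.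
case: hU => [hU|]; last by rewrite -tE ltNge tb.
by apply: tU; rewrite tE hU U_hatE lam_cross_sU.
Qed.

Lemma graph_plus_sub h a b : sU nu <= a -> b <= 1 -> h (sU nu) = 2 \/ sU nu < a ->
  (forall t, a <= t <= b -> lower_plus nu t <= h t <= upper_plus nu t) ->
  graph h a b `\ U_hat mu `<=` T_plus mu.
Proof.
move=> Ua b1 hU hlu; rewrite T_plusE => _ [[t + <-]].
rewrite /= in_itv/= => tab tU; exists (t, h t) => //.
have /andP[at_ tb] := tab.
split=> /=; last exact: hlu.
rewrite (le_trans tb b1) andbT lt_neqAle (le_trans Ua at_) andbT; apply/eqP => tE.
case: hU => [hU|]; last by rewrite tE ltNge at_.
by apply: tU; rewrite -tE hU U_hatE lam_cross_sU.
Qed.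

(** * The curves as arcs on the surface *)

Lemma SCBm_connects : connects_in mu (T_minus mu)
  (left_curve mu (SCB_pairs mu)) (D1_hat mu) (U_hat mu).
Proof.
rewrite /connects_in SCBm_graph; split.
  apply: graph_minus_sub; rewrite ?(ltW D21)//; first by left; rewrite lam_cross_sU.
  move=> t /andP[t1 t2].
  rewrite -[lam_cross nu t]lower_minus_high// lexx lower_minus_le_upper_minus//.
  by rewrite t2 (le_trans (ltW D21)).
rewrite D1_hatE U_hatE.
exact: (graph_arc (ltW D1U) (lam_cross_continuous nu1)).1.
Qed.

Lemma SCBp_connects : connects_in mu (T_plus mu)
  (right_curve mu (SCB_pairs mu)) (U_hat mu) (D_hat mu).
Proof.
rewrite /connects_in SCBp_graph; split.
  apply: graph_plus_sub => //; first by left; rewrite lower_plus_sU.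
  by move=> t tU; rewrite lexx lower_plus_le_upper_plus.
rewrite D_hatE U_hatE -[lam_cross nu (sU nu)](_ : lower_plus nu (sU nu) = _); last first.
  by rewrite /lower_plus contact_sU.
exact: (graph_arc (ltW U1) (lam_cross_contact_continuous : continuous (lower_plus nu))).1.
Qed.

Lemma FCBm_connects : connects_in mu (T_minus mu)
  (left_curve mu (FCB_pairs mu)) (calY_hat mu) (U_hat mu).
Proof.
rewrite /connects_in FCBm_graph; split.
  apply: graph_minus_sub => //; first by left; rewrite contact_sU// lam_cross_sU.
  move=> t /andP[t1 t2].
  rewrite -[lam_cross nu (contact nu t)]upper_minus_high ?t1// lexx.
  rewrite lower_minus_le_upper_minus//.
  by rewrite t2 (le_trans D2c).
rewrite calY_hatE; have -> : U_hat mu = (L (sU nu), lam_cross nu (contact nu (sU nu))).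
  by rewrite contact_sU// U_hatE.
exact: (graph_arc (ltW cU) lam_cross_contact_continuous).1.
Qed.

Lemma FCBp_connects : connects_in mu (T_plus mu)
  (right_curve mu (FCB_pairs mu)) (U_hat mu) (Y_hat mu).
Proof.
rewrite /connects_in FCBp_graph; split.
  apply: graph_plus_sub => //; first by left; rewrite lam_cross_sU.
  move=> t /andP[t1 t2].
  rewrite -[lam_cross nu t]upper_plus_low ?t1// lexx lower_plus_le_upper_plus//.
  by rewrite t1 (le_trans t2).
rewrite Y_hatE U_hatE.
exact: (graph_arc (ltW Uy) (lam_cross_continuous nu1)).1.
Qed.

Lemma UCBm_connects : connects_in mu (T_minus mu)
  (left_curve mu (UCB_pairs mu)) (D2_hat mu) (calY_hat mu).
Proof.
rewrite /connects_in UCBm_graph; split.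
  apply: graph_minus_sub => //; rewrite ?(ltW cU)//; first by right.
  move=> t /andP[t1 t2].
  rewrite -[lam_along nu t]upper_minus_low ?t2 ?(lt_le_trans D20)// lexx.
  rewrite lower_minus_le_upper_minus//.
  by rewrite t1 (le_trans t2) ?ltW.
have -> : calY_hat mu = (L (sCY nu), lam_along nu (sCY nu)).
  rewrite calY_hatE -[lam_cross nu _]upper_minus_high ?lexx ?(ltW cU)//.
  by rewrite upper_minus_low// lexx sCY_gt0.
rewrite D2_hatE; exact: (graph_arc D2c (lam_along_continuous nu1)).1.
Qed.

Lemma UCBp_connects : connects_in mu (T_plus mu)
  (right_curve mu (UCB_pairs mu)) (D_check mu) (Y_hat mu).
Proof.
have YE : lam_cross nu (sY nu) = chord nu (tangent nu (sY nu)) (sY nu).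
  by rewrite tangent_sY// -contact_sCY// lam_cross_chord_contact// chordC.
rewrite /connects_in UCBp_graph; split.
  apply: graph_plus_sub => //; rewrite ?(ltW Uy)//; first by right.
  move=> t /andP[yt t1].
  have -> : chord nu (tangent nu t) t = upper_plus nu t.
    move: yt; rewrite le_eqVlt => /predU1P[<-|yt]; last by rewrite upper_plus_high.
    by rewrite -YE upper_plus_low// lexx ltW.
  by rewrite lexx andbT lower_plus_le_upper_plus// t1 (le_trans (ltW Uy)).
rewrite D_checkE Y_hatE YE; exact: (graph_arc y1 chord_tangent_continuous).2.
Qed.

Lemma GUBm_connects : connects_in mu (T_minus mu)
  (left_curve mu (GUB_pairs mu)) (D2_hat mu) (D1_hat mu).
Proof.
rewrite /connects_in GUBm_graph; split.
  apply: graph_minus_sub => //; rewrite ?(ltW D1U)//; first by right.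
  move=> t /andP[t1 t2].
  rewrite -[chord nu t 1]lower_minus_low// lexx lower_minus_le_upper_minus//.
  by rewrite t1 (le_trans t2) ?ltW.
rewrite D2_hatE D1_hatE lam_along_sD2// -[lam_cross nu (sD1 nu)]lower_minus_high//.
rewrite lower_minus_low//.
apply: (graph_arc (ltW D21) _).1.
exact: (chord_comp_continuous nu1 (@continuous_id R) (@continuous_cst R 1)).
Qed.

Lemma GUBp_connects : connects_in mu (T_plus mu)
  (right_curve mu (GUB_pairs mu)) (D_check mu) (D_hat mu).
Proof.
have hi1 : chord nu (tangent nu 1) 1 = upper_plus nu 1.
  move: y1; rewrite le_eqVlt => /predU1P[yE|yl]; last by rewrite upper_plus_high.
  rewrite upper_plus_low ?yE ?lexx ?(ltW U1)// -yE tangent_sY//.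
  by rewrite -contact_sCY// lam_cross_chord_contact// chordC.
have lh : lower_plus nu 1 <= upper_plus nu 1.
  by rewrite lower_plus_le_upper_plus// lexx ltW.
rewrite /connects_in GUBp_vertical; split.
  rewrite T_plusE => _ [[v + <-] _]; rewrite /= in_itv/= => vb.
  by exists (1, v) => //; split=> //=; rewrite U1/=.
rewrite D_checkE D_hatE hi1 -/(lower_plus nu 1).
apply: (@arc_of_segment _ (fun v => (L 1, v)) _ _ lh _ _).2.
  by apply: pair_continuous => v; [exact: cvg_cst|exact: cvg_id].
by move=> v w _ _ [].
Qed.

End InvariantLine.

Unset Implicit Arguments.

Theorem lemma6p1 (R : realType) (mu : viscosity R)
    (hw : 0 < mu_w mu) (ho : 0 < mu_o mu) (hg : 0 < mu_g mu)
    (hnu1 : 1 < nuG mu) (hnu8 : nuG mu <= 8) :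
  let SCBm := left_curve mu (SCB_pairs mu) in
  let SCBp := right_curve mu (SCB_pairs mu) in
  let FCBm := left_curve mu (FCB_pairs mu) in
  let FCBp := right_curve mu (FCB_pairs mu) in
  let UCBm := left_curve mu (UCB_pairs mu) in
  let UCBp := right_curve mu (UCB_pairs mu) in
  let GUBm := left_curve mu (GUB_pairs mu) in
  let GUBp := right_curve mu (GUB_pairs mu) in
  [/\ plane_boundary mu (T_minus mu) =
        with_ends SCBm (D1_hat mu) (U_hat mu) `|`
        with_ends FCBm (calY_hat mu) (U_hat mu) `|`
        with_ends UCBm (D2_hat mu) (calY_hat mu) `|`
        with_ends GUBm (D2_hat mu) (D1_hat mu) /\
      plane_boundary mu (T_plus mu) =
        with_ends SCBp (U_hat mu) (D_hat mu) `|`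
        with_ends FCBp (U_hat mu) (Y_hat mu) `|`
        with_ends UCBp (D_check mu) (Y_hat mu) `|`
        with_ends GUBp (D_check mu) (D_hat mu),
      connects_in mu (T_minus mu) SCBm (D1_hat mu) (U_hat mu) /\
      connects_in mu (T_plus mu) SCBp (U_hat mu) (D_hat mu),
      connects_in mu (T_minus mu) FCBm (calY_hat mu) (U_hat mu) /\
      connects_in mu (T_plus mu) FCBp (U_hat mu) (Y_hat mu),
      connects_in mu (T_minus mu) UCBm (D2_hat mu) (calY_hat mu) /\
      connects_in mu (T_plus mu) UCBp (D_check mu) (Y_hat mu) &
      connects_in mu (T_minus mu) GUBm (D2_hat mu) (D1_hat mu) /\
      connects_in mu (T_plus mu) GUBp (D_check mu) (D_hat mu)].
Proof.
move=> SCBm SCBp FCBm FCBp UCBm UCBp GUBm GUBp; split; split.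
- rewrite T_minus_boundary// /SCBm /FCBm /UCBm /GUBm.
  by rewrite SCBm_graph// FCBm_graph// UCBm_graph// GUBm_graph.
- rewrite T_plus_boundary// /SCBp /FCBp /UCBp /GUBp.
  by rewrite SCBp_graph// FCBp_graph// UCBp_graph// GUBp_vertical.
- exact: SCBm_connects.
- exact: SCBp_connects.
- exact: FCBm_connects.
- exact: FCBp_connects.
- exact: UCBm_connects.
- exact: UCBp_connects.
- exact: GUBm_connects.
- exact: GUBp_connects.
Qed.
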